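(* Let $(\mathcal{S},G,\mathfrak{g},\alpha)$ be an operator system dynamical system, and suppose that $\mathcal{S}$ is hyperrigid. Then the full enveloping crossed product $\mathcal{S}\rtimes_{\alpha,\mathrm{env}}\mathfrak{g}$ is hyperrigid. In particular, $C^*_{\mathrm{env}}(\mathcal{S}\rtimes_{\alpha,\mathrm{env}}\mathfrak{g})\simeq C^*_{\mathrm{env}}(\mathcal{S})\rtimes_{\alpha}G$.
   Context: An (operator system) dynamical system $(\mathcal{S},G,\mathfrak{g},\alpha)$ consists of an operator system $\mathcal{S}$, a discrete group $G$, a generating set $\mathfrak{g}$ of $G$ with $\mathfrak{g}^{-1}=\mathfrak{g}$ and $e\in\mathfrak{g}$, and a group homomorphism $\alpha:G\to\mathrm{Aut}(\mathcal{S})$ into the group of unital complete order isomorphisms of $\mathcal{S}$. $C^*_{\mathrm{env}}(\mathcal{S})$ is the $C^*$-envelope of $\mathcal{S}$. The action $\alpha$ extends uniquely to an action of $G$ on $C^*_{\mathrm{env}}(\mathcal{S})$ by $*$-automorphisms, again denoted $\alpha$. The full enveloping crossed product is the operator subsystem $\mathcal{S}\rtimes_{\alpha,\mathrm{env}}\mathfrak{g}:=\mathrm{span}\{au_g:a\in\mathcal{S},g\in\mathfrak{g}\}$ of the full $C^*$-crossed product $C^*_{\mathrm{env}}(\mathcal{S})\rtimes_{\alpha}G$, where $u_g$ are the canonical unitaries. An operator system $\mathcal{T}$ generating a unital $C^*$-algebra $\mathcal{C}$ is hyperrigid in $\mathcal{C}$ if for every unital $*$-representation $\pi:\mathcal{C}\to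 B(\mathcal{H})$, $\pi$ is the only unital completely positive map $\mathcal{C}\to B(\mathcal{H})$ extending $\pi|_{\mathcal{T}}$. Here ''$\mathcal{S}$ is hyperrigid'' means hyperrigid in $C^*_{\mathrm{env}}(\mathcal{S})$, and ''$\mathcal{S}\rtimes_{\alpha,\mathrm{env}}\mathfrak{g}$ is hyperrigid'' means hyperrigid in the $C^*$-algebra $C^*_{\mathrm{env}}(\mathcal{S})\rtimes_{\alpha}G$ that it generates. The isomorphism is the canonical one, compatible with the inclusions of $\mathcal{S}\rtimes_{\alpha,\mathrm{env}}\mathfrak{g}$. *)

(* Defs.v *)
(* The complex numbers are R[i] for R : realType. *)
From HB Require Import structures.
From mathcomp Require Import all_boot all_order all_algebra.
From mathcomp Require Import sesquilinear.
From mathcomp Require Import all_classical all_reals all_analysis.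
From mathcomp Require Import complex.
Set Implicit Arguments.
Unset Strict Implicit.
Unset Printing Implicit Defensive.
Import Order.TTheory GRing.Theory Num.Theory.
Import numFieldNormedType.Exports.
Local Open Scope classical_set_scope.
Local Open Scope ring_scope.

(* The inner product is linear in its first argument. *)
HB.mixin Record isHilbert (R : realType) H & CompleteNormedModule R[i] H := {
  hdot : {dot H for @Num.conj R[i]} ;
  hdotE : forall x : H, `|x| ^+ 2 = hdot x x
}.

#[short(type="hilbertType")]
HB.structure Definition Hilbert (R : realType) :=
  {H of CompleteNormedModule R[i] H & isHilbert R H}.

(* As for normed modules over R[i], the norm takes its values in the nonnegative
   reals of R[i]. HB admits no join of [GRing.Algebra] and [NormedModule]
   ([Num.NumDomain] already inherits from the ring and the norm structures), so
   the norm and its completeness are part of the mixin. *)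
HB.mixin Record isCStarAlg (R : realType) A & GRing.Algebra R[i] A := {
  star : A -> A ;
  cnorm : A -> R[i] ;
  starK : involutive star ;
  starD : {morph star : a b / a + b} ;
  starZ : forall (c : R[i]) (a : A), star (c *: a) = Num.conj c *: star a ;
  starM : forall a b : A, star (a * b) = star b * star a ;
  cnorm_ge0 : forall a : A, 0 <= cnorm a ;
  cnorm_eq0 : forall a : A, cnorm a = 0 -> a = 0 ;
  cnormD : forall a b : A, cnorm (a + b) <= cnorm a + cnorm b ;
  cnormZ : forall (c : R[i]) (a : A), cnorm (c *: a) = `|c| * cnorm a ;
  cnormM : forall a b : A, cnorm (a * b) <= cnorm a * cnorm b ;
  cnorm_star : forall a : A, cnorm (star a * a) = cnorm a ^+ 2 ;
  cnorm_complete : forall s : nat -> A,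
    (forall e : R[i], 0 < e -> exists N, forall m n : nat,
       (N <= m)%N -> (N <= n)%N -> cnorm (s m - s n) < e) ->
    exists l : A, forall e : R[i], 0 < e ->
      exists N, forall n : nat, (N <= n)%N -> cnorm (s n - l) < e
}.

(* Unital C*-algebras. *)
#[short(type="cstarAlgType")]
HB.structure Definition CStarAlg (R : realType) :=
  {A of GRing.Algebra R[i] A & isCStarAlg R A}.

Section CStar.
Context {R : realType}.
Local Notation C := R[i].
Implicit Types A B D E P : cstarAlgType R.

Definition starmx {A} {m n} (X : 'M[A]_(m, n)) : 'M[A]_(n, m) :=
  \matrix_(k, l) star (X l k).

(* Positive elements of the C*-algebra M_n(A). *)
Definition mxpos {A} {n} (X : 'M[A]_n) : Prop :=
  exists Y : 'M[A]_n, X = starmx Y *m Y.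

Definition star_preserving {A D} (f : A -> D) : Prop :=
  forall a, f (star a) = star (f a).

Definition unitary {A} (v : A) : Prop := star v * v = 1 /\ v * star v = 1.

Definition norm_closure {A} (X : set A) : set A :=
  [set x | forall e : C, 0 < e -> exists y, X y /\ cnorm (x - y) < e].

Definition lspan {A} (X : set A) : set A :=
  [set x | exists n (c : 'I_n -> C) (v : 'I_n -> A),
     (forall k, X (v k)) /\ x = \sum_k c k *: v k].

Definition cstar_subalgebra {A} (B : set A) : Prop :=
  [/\ norm_closure B `<=` B, B 1,
      forall (c : C) x y, B x -> B y -> B (c *: x + y),
      forall x y, B x -> B y -> B (x * y)
    & forall x, B x -> B (star x)].

Definition cstar_generates {A} (X : set A) : Prop :=
  forall B : set A, cstar_subalgebra B -> X `<=` B -> B = setT.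

(* Operator systems are taken concretely, inside a unital C*-algebra; they need
   not be closed. *)
Definition operator_system {A} (S : set A) : Prop :=
  [/\ S 1,
      forall (c : C) x y, S x -> S y -> S (c *: x + y)
    & forall x, S x -> S (star x)].

(* [S] is coerced to the type [{x : A | x \in S}], so that ['M[S]_n] is M_n(S);
   linearity and unitality of [j] are expressed through the inclusion [val]. *)
Definition unital_complete_order_embedding {A D} (S : set A) (j : S -> D) :
    Prop :=
  [/\ forall (c : C) (x y z : S),
        val z = c *: val x + val y -> j z = c *: j x + j y,
      forall x : S, val x = 1 -> j x = 1
    & forall n (X : 'M[S]_n),
        mxpos (map_mx val X : 'M[A]_n) <-> mxpos (map_mx j X)].

Definition unital_complete_order_automorphism {A} (S : set A) (f : S -> S) :
    Prop :=
  bijective f /\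
  unital_complete_order_embedding (fun s : S => val (f s) : A).

(* [(E, iota)] is the C*-envelope of [S]: the C*-cover of [S] that is a quotient
   of every other one. Since [j] has generating range, [pi] is unique, and it is
   onto since [iota] has generating range. *)
Definition cstar_envelope {A E} (S : set A) (iota : S -> E) : Prop :=
  [/\ unital_complete_order_embedding iota,
      cstar_generates (range iota)
    & forall D (j : S -> D),
        unital_complete_order_embedding j -> cstar_generates (range j) ->
        exists pi : {lrmorphism D -> E},
          star_preserving pi /\ forall s, pi (j s) = iota s].

Definition bounded_operator {H : hilbertType R} (f : H -> H) : Prop :=
  linear f /\ exists M : C, forall x, `|f x| <= M * `|x|.

Definition unital_star_rep {A} {H : hilbertType R} (pi : A -> H -> H) : Prop :=
  [/\ forall a, bounded_operator (pi a),
      forall (c : C) a b x, pi (c *: a + b) x = c *: pi a x + pi b x,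
      forall x, pi 1 x = x,
      forall a b x, pi (a * b) x = pi a (pi b x)
    & forall a x y, hdot (pi (star a) x) y = hdot x (pi a y)].

(* The last clause is positivity of the operator matrix (phi (X k l)) on H^n. *)
Definition ucp {A} {H : hilbertType R} (phi : A -> H -> H) : Prop :=
  [/\ forall a, bounded_operator (phi a),
      forall (c : C) a b x, phi (c *: a + b) x = c *: phi a x + phi b x,
      forall x, phi 1 x = x
    & forall n (X : 'M[A]_n), mxpos X -> forall xi : 'I_n -> H,
        0 <= \sum_k \sum_l hdot (phi (X k l) (xi l)) (xi k)].

Definition hyperrigid {A} (T : set A) : Prop :=
  [/\ operator_system T, cstar_generates T
    & forall (H : hilbertType R) (pi phi : A -> H -> H),
        unital_star_rep pi -> ucp phi ->
        (forall t, T t -> phi t = pi t) -> phi = pi].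

Section Group.
Context {G : groupType}.
Implicit Types (gs : set G) (g h : G).

Definition group_generates gs : Prop :=
  forall K : set G, K 1%g -> (forall g h, K g -> K h -> K (g * h)%g) ->
    (forall g, K g -> K g^-1%g) -> gs `<=` K -> K = setT.

Definition dynamical_system {A} (S : set A) gs (alpha : G -> S -> S) : Prop :=
  [/\ operator_system S,
      [/\ group_generates gs, gs 1%g & forall g, gs g -> gs g^-1%g],
      forall g, unital_complete_order_automorphism (alpha g)
    & forall g h s, alpha (g * h)%g s = alpha g (alpha h s)].

(* Action by *-automorphisms; bijectivity of each [beta g] follows. *)
Definition star_action {A} (beta : G -> {lrmorphism A -> A}) : Prop :=
  [/\ forall g, star_preserving (beta g),
      forall a, beta 1%g a = a
    & forall g h a, beta (g * h)%g a = beta g (beta h a)].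

Definition covariant_rep {A} (beta : G -> {lrmorphism A -> A})
    {H : hilbertType R} (pi : A -> H -> H) (U : G -> H -> H) : Prop :=
  [/\ unital_star_rep pi,
      [/\ forall g, linear (U g), forall x, U 1%g x = x,
          forall g h x, U (g * h)%g x = U g (U h x)
        & forall g x y, hdot (U g x) (U g y) = hdot x y]
    & forall g a x, U g (pi a (U g^-1%g x)) = pi (beta g a) x].

(* [M] bounds the norms of [\sum_k pi (a k) U_(g k)] over all covariant
   representations [(pi, U)]. *)
Definition universal_norm_le {A} (beta : G -> {lrmorphism A -> A})
    n (a : 'I_n -> A) (g : 'I_n -> G) (M : C) : Prop :=
  forall (H : hilbertType R) (pi : A -> H -> H) (U : G -> H -> H),
    covariant_rep beta pi U ->
    forall x, `|\sum_k pi (a k) (U (g k) x)| <= M * `|x|.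

(* [(P, i, u)] is the full crossed product of [A] by [beta]: the completion, for
   the universal norm, of the *-algebra of finite sums [\sum_k (a k) u_(g k)]. *)
Definition full_crossed_product {A P} (beta : G -> {lrmorphism A -> A})
    (i : {lrmorphism A -> P}) (u : G -> P) : Prop :=
  [/\ star_preserving i,
      [/\ forall g, unitary (u g), forall g h, u (g * h)%g = u g * u h
        & forall g a, u g * i a * star (u g) = i (beta g a)],
      norm_closure [set x | exists n (a : 'I_n -> A) (g : 'I_n -> G),
                 x = \sum_k i (a k) * u (g k)] = setT
    & forall n (a : 'I_n -> A) (g : 'I_n -> G),
        universal_norm_le beta a g (cnorm (\sum_k i (a k) * u (g k))) /\
        forall M : C, 0 <= M -> universal_norm_le beta a g M ->
          cnorm (\sum_k i (a k) * u (g k)) <= M].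

(* span {a u_g : a in S, g in gs}, where [S] sits in [E] through [iota] and [E]
   in [P] through [i]. *)
Definition enveloping_crossed_product {A E P} (S : set A) (iota : S -> E)
    gs (i : E -> P) (u : G -> P) : set P :=
  lspan [set x | exists s g, gs g /\ x = i (iota s) * u g].

End Group.
End CStar.

(* Main.v *)
Require Import Defs.
From HB Require Import structures.
From mathcomp Require Import all_boot all_order all_algebra.
From mathcomp Require Import sesquilinear.
From mathcomp Require Import all_classical all_reals all_analysis.
From mathcomp Require Import complex.
From mathcomp Require Import ring lra.
Set Implicit Arguments.
Unset Strict Implicit.
Unset Printing Implicit Defensive.
Import Order.TTheory GRing.Theory Num.Theory.
Import numFieldNormedType.Exports.
Local Open Scope classical_set_scope.
Local Open Scope ring_scope.
Local Open Scope complex_scope.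

(** Write [T] for the enveloping crossed product, the span of the [i (iota s) * u g]
    in [P]. The theorem has two parts: [T] is hyperrigid, and an operator system
    that is hyperrigid in a C*-algebra [P] has [P] as its C*-envelope.

    Hyperrigidity of [T] ([crossed_product_hyperrigid]). Let [pi] be a
    representation of [P] and [phi] a unital completely positive map that agrees
    with [pi] on [T]. On the copy of the envelope of [S] the two agree, because [S]
    is hyperrigid; on the unitaries [u g] with [g] in the generating set they
    agree because [T] contains them. Since [pi] is multiplicative, these elements
    lie in the multiplicative domain of [phi] ([multiplicative_domain]). They
    generate a dense *-algebra, so [phi = pi].

    From hyperrigidity to the envelope ([hyperrigid_cstar_envelope]). Let [j] embed
    [T] into a C*-algebra [D] that its range generates, and let [pi] be a
    representation of [P] on [H]. By Arveson's theorem [pi], transported to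
    [j T], extends to a completely positive map [psi] on [D]. To see that [psi] is
    multiplicative, let [D] act on the Stinespring space of [psi] and extend [j],
    followed by this action, to a completely positive map on [P], again by Arveson.
    Compressed to [H] this extension agrees with [pi] on [T], so by hyperrigidity it
    is [pi]. The Schwarz inequality for it reads
    [psi (star (j t) * j t) <= star (pi t) * pi t], the inequality opposite to the
    Schwarz inequality for [psi]; hence [j T] lies in the multiplicative domain of
    [psi] ([extends_rep_mult]). So [psi] sends every *-polynomial in [j T] to the
    image under [pi] of the same polynomial in [T]. When the representations of [P]
    determine its norm, *-polynomials have in [T] at most the norm that they have
    in [j T], and the closure of the correspondence between them is the graph of
    the required *-morphism from [D] to [P] ([cover_morphism]). For a crossed
    product the hypothesis on the norm holds because its norm is a supremum over
    covariant representations, each of which extends to a representation of [P]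
    ([crossed_product_norm_by_reps]).

    No algebra of operators and no Stinespring space is constructed: a completely
    positive map is represented by the kernel of its matrix coefficients
    ([pos_kernel]), indexed by an arbitrary set of vectors. For kernels Arveson's
    theorem ([arveson_extension]) is one application of M. Riesz's extension theorem
    ([positive_extension]), and the second extension above is indexed by the pairs
    [(d, x)] that stand for the tensors [d (x) x]. Operators come back through the
    Riesz representation theorem ([riesz_representation]) when hyperrigidity is
    used. Positivity in an abstract C*-algebra rests on the square root of [1 - a]
    for a hermitian [a] with norm less than 1 ([sqrt_one_sub]), which also shows
    that *-morphisms are contractive ([star_morphism_contractive]). *)

(** * Norm and convergence in a C*-algebra *)

Section Scalars.
Context {R : realType}.
Local Notation C := R[i].

Lemma conjcE (c : C) : Num.conj c = conjc c.
Proof.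
have [->|c0] := eqVneq c 0; first by rewrite rmorph0 conjc0.
by apply: (mulfI c0); rewrite -normCK sqr_normc.
Qed.

Lemma conjc_i : 'i^* = - 'i :> C.
Proof. by apply/eqP; rewrite eq_complex /= oppr0 !eqxx. Qed.

Lemma scale_half (V : lmodType C) (v : V) : (2^-1 : R)%:C *: (v + v) = v.
Proof.
rewrite scalerDr -scalerDl -rmorphD /=.
have -> : (2^-1 + 2^-1 : R) = 1 by lra.
by rewrite rmorph1 scale1r.
Qed.
End Scalars.

Section Norm.
Context {R : realType} {A : cstarAlgType R}.
Implicit Types a b : A.
Local Notation C := R[i].

(** The norm has its values in [R[i]]; its real part gives access to the order
    and the arithmetic of the real field. *)
Definition nm (a : A) : R := complex.Re (cnorm a).

Lemma cnormE a : cnorm a = (nm a)%:C.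
Proof. by rewrite /nm RRe_real // ger0_real // cnorm_ge0. Qed.

Lemma nm_ge0 a : 0 <= nm a.
Proof. by rewrite -lecR -cnormE cnorm_ge0. Qed.

Lemma nm_eq0 a : nm a = 0 -> a = 0.
Proof. by move=> h; apply: cnorm_eq0; rewrite cnormE h. Qed.

Lemma nmD a b : nm (a + b) <= nm a + nm b.
Proof. by rewrite -lecR rmorphD /= -!cnormE cnormD. Qed.

Lemma nmZ (c : C) a : nm (c *: a) = complex.Re `|c| * nm a.
Proof.
apply: complexI; rewrite -cnormE cnormZ rmorphM /= -cnormE; congr (_ * _).
Qed.

Lemma nmM a b : nm (a * b) <= nm a * nm b.
Proof. by rewrite -lecR rmorphM /= -!cnormE cnormM. Qed.

Lemma nmZr (r : R) a : nm (r%:C *: a) = `|r| * nm a.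
Proof.
by rewrite nmZ normc_def /= expr0n addr0 sqrtr_sqr.
Qed.

Lemma nm0 : nm (0 : A) = 0.
Proof. by rewrite -(scale0r (0 : A)) nmZ normr0 mul0r. Qed.

Lemma nmN a : nm (- a) = nm a.
Proof. by rewrite -scaleN1r nmZ normrN1 mul1r. Qed.

Lemma nmB a b : nm (a - b) = nm (b - a).
Proof. by rewrite -nmN opprB. Qed.

Lemma nm_star_mul a : nm (star a * a) = nm a ^+ 2.
Proof. by apply: complexI; rewrite -cnormE cnorm_star cnormE rmorphXn. Qed.

Lemma nm_star a : nm (star a) = nm a.
Proof.
have le b : nm b <= nm (star b).
  have [/eqP ->|b0] := boolP (nm b == 0); first exact: nm_ge0.
  rewrite -(@ler_pM2r _ (nm b)) ?lt_def ?b0 ?nm_ge0//.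
  by rewrite -expr2 -nm_star_mul nmM.
by apply/eqP; rewrite eq_le le andbT -{2}(starK a) le.
Qed.

Lemma star1 : star (1 : A) = 1.
Proof. by rewrite -[LHS]mulr1 -{2}(starK (1 : A)) -starM mulr1 starK. Qed.

Lemma nm1_le : nm (1 : A) <= 1.
Proof.
have := nm_star_mul (1 : A); rewrite star1 mulr1 => h.
have := nm_ge0 (1 : A); nra.
Qed.

Lemma star0 : star (0 : A) = 0.
Proof. by apply: (addrI (star 0)); rewrite -starD !addr0. Qed.

Lemma starN a : star (- a) = - star a.
Proof. by apply: (addrI (star a)); rewrite -starD !subrr star0. Qed.

Lemma starB a b : star (a - b) = star a - star b.
Proof. by rewrite starD starN. Qed.

Lemma star_sum I (s : seq I) (P : pred I) (F : I -> A) :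
  star (\sum_(i <- s | P i) F i) = \sum_(i <- s | P i) star (F i).
Proof. by apply: big_morph; [exact: starD|exact: star0]. Qed.

Lemma starZr (r : R) a : star (r%:C *: a) = r%:C *: star a.
Proof. by rewrite starZ conjcE conjc_real. Qed.

Definition clim (s : nat -> A) (l : A) := (fun n => nm (s n - l)) @ \oo --> (0 : R).

Lemma clim_le (s : nat -> A) l (t : nat -> R) :
  (forall n, nm (s n - l) <= t n) -> t @ \oo --> (0 : R) -> clim s l.
Proof.
move=> h ht; apply: (squeeze_cvgr _ (cvg_cst 0) ht).
by apply: nearW => n; rewrite nm_ge0 h.
Qed.

Lemma clim_cst l : clim (fun=> l) l.
Proof. by rewrite /clim subrr nm0; exact: cvg_cst. Qed.

Lemma climD s t l m : clim s l -> clim t m -> clim (fun n => s n + t n) (l + m).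
Proof.
move=> hs ht; apply: (@clim_le _ _ (fun n => nm (s n - l) + nm (t n - m))).
  by move=> n; rewrite opprD addrACA nmD.
by rewrite -[0](addr0 (0 : R)); exact: cvgD.
Qed.

Lemma climZ (c : C) s l : clim s l -> clim (fun n => c *: s n) (c *: l).
Proof.
move=> hs; apply: (@clim_le _ _ (fun n => complex.Re `|c| * nm (s n - l))).
  by move=> n; rewrite -scalerBr nmZ.
by rewrite -[0](mulr0 (complex.Re `|c|)); apply: cvgM => //; exact: cvg_cst.
Qed.

Lemma climM s t l m : clim s l -> clim t m -> clim (fun n => s n * t n) (l * m).
Proof.
move=> hs ht.
apply: (@clim_le _ _ (fun n => nm (s n - l) * (nm (t n - m) + nm m)
                               + nm l * nm (t n - m))).
  move=> n; have -> : s n * t n - l * m = (s n - l) * t n + l * (t n - m).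
    by rewrite mulrBl mulrBr addrA subrK.
  apply: (le_trans (nmD _ _)); apply: lerD; last exact: nmM.
  apply: (le_trans (nmM _ _)); apply: ler_wpM2l; first exact: nm_ge0.
  by rewrite -{1}(subrK m (t n)) nmD.
rewrite -[X in _ --> X](_ : 0 * (0 + nm m) + nm l * 0 = 0); last by rewrite mul0r mulr0 addr0.
apply: cvgD; apply: cvgM => //; last exact: cvg_cst.
by apply: cvgD => //; exact: cvg_cst.
Qed.

Lemma clim_star s l : clim s l -> clim (fun n => star (s n)) (star l).
Proof. by move=> hs; apply: (clim_le _ hs) => n; rewrite -starB nm_star. Qed.

Lemma climS s l : clim s l -> clim (fun n => s n.+1) l.
Proof. by move=> hs; rewrite /clim (cvg_shiftS (fun n => nm (s n - l))). Qed.

Lemma clim_nm s l : clim s l -> (fun n => nm (s n)) @ \oo --> nm l.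
Proof.
move=> hs; apply: (@squeeze_cvgr _ _ _ _ (fun n => nm l - nm (s n - l)) (fun n => nm l + nm (s n - l))).
- apply: nearW => n; have := nmD (s n) (l - s n); have := nmD l (s n - l).
  rewrite nmB (nmB l) !subrKC; lra.
- by rewrite -[X in _ --> X]subr0; apply: cvgB => //; exact: cvg_cst.
- by rewrite -[X in _ --> X]addr0; apply: cvgD => //; exact: cvg_cst.
Qed.

Lemma clim_nm_le s l (M : R) : clim s l -> (forall n, nm (s n) <= M) -> nm l <= M.
Proof.
move=> /clim_nm hs h.
by apply: (ler_cvg_to hs (cvg_cst M)); apply: nearW.
Qed.

Lemma clim_unique s l m : clim s l -> clim s m -> l = m.
Proof.
move=> hl hm; have := climD hl (climZ (-1) hm); under eq_fun do rewrite scaleN1r subrr.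
rewrite scaleN1r => h; apply/eqP; rewrite -subr_eq0; apply/eqP/nm_eq0/le_anti.
by rewrite nm_ge0 andbT; apply: (clim_nm_le h) => n; rewrite nm0.
Qed.

Lemma clim_complete (s : nat -> A) (t : nat -> R) :
  t @ \oo --> (0 : R) -> (forall m n, (n <= m)%N -> nm (s m - s n) <= t n) ->
  exists l, clim s l.
Proof.
move=> ht h.
have [l hl] : exists l : A, forall e : C, 0 < e ->
      exists N, forall n : nat, (N <= n)%N -> cnorm (s n - l) < e.
  apply: cnorm_complete => e e0.
  have [d d0 ->] : exists2 d : R, 0 < d & e = d%:C.
    exists (complex.Re e); first by move: e0; rewrite ltcE /= => /andP[].
    by rewrite RRe_real // gtr0_real.
  have /cvgrPdist_lt/(_ d d0)[N _ hN] := ht.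
  have tN n : (N <= n)%N -> t n < d.
    by move=> /hN /=; rewrite sub0r normrN; apply: le_lt_trans; exact: ler_norm.
  exists N => m n Nm Nn; rewrite cnormE ltcR.
  case: (leqP n m) => [nm|/ltnW mn].
    exact: le_lt_trans (h _ _ nm) (tN _ Nn).
  by rewrite nmB; exact: le_lt_trans (h _ _ mn) (tN _ Nm).
exists l; apply/cvgrPdist_lt => e e0.
have [|N hN] := hl e%:C; first by rewrite ltcR.
exists N => // n /= /hN; rewrite cnormE ltcR sub0r normrN.
by rewrite ger0_norm ?nm_ge0.
Qed.

Lemma norm_closure_seq (X : set A) l : norm_closure X l ->
  exists s, (forall n, X (s n)) /\ forall n, nm (s n - l) <= harmonic n.
Proof.
move=> h.
have /choice[s hs] : forall n : nat, exists y, X y /\ nm (l - y) < n.+1%:R^-1.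
  move=> n; have [|y [Xy hy]] := h ((n.+1%:R^-1 : R)%:C); first by rewrite ltcR invr_gt0.
  by exists y; rewrite -ltcR -cnormE.
by exists s; split=> n; [|rewrite nmB; apply: ltW]; case: (hs n).
Qed.

Lemma harmonic_clim (s : nat -> A) l : (forall n, nm (s n - l) <= harmonic n) -> clim s l.
Proof. by move=> h; apply: (clim_le h); exact: cvg_harmonic. Qed.

Lemma clim_norm_closure (X : set A) s l : (forall n, X (s n)) -> clim s l -> norm_closure X l.
Proof.
move=> Xs hs e e0.
have d0 : 0 < complex.Re e by move: e0; rewrite ltcE /= => /andP[].
have /cvgrPdist_lt/(_ _ d0)[N _ hN] := hs.
exists (s N); split=> //; move: (hN N (leqnn N)) => /=.
rewrite sub0r normrN ger0_norm ?nm_ge0// nmB -ltcR -cnormE RRe_real//.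
exact: gtr0_real.
Qed.

(** The map [y |-> (a + y ^ 2) / 2] contracts the ball of radius [nm a] by the
    factor [nm a]; its fixed point [l] satisfies [(1 - l) ^ 2 = 1 - a], and it is
    a limit of polynomials in [a]. All the functional calculus of the proof is
    contained in this square root. *)
Lemma sqrt_one_sub a : star a = a -> nm a < 1 ->
  exists y, [/\ star y = y, y * y = 1 - a
    & forall b, a * b = b * a -> y * b = b * y].
Proof.
move=> sa a1; set r := nm a.
have r0 : 0 <= r := nm_ge0 a.
pose h : R := 2^-1.
have h2 : h *+ 2 = 1 by rewrite /h mulr2n; lra.
(* the iterates of the contraction, started at 0 *)
pose y := fix y n := if n is n'.+1 then h%:C *: (a + y n' * y n') else 0 : A.
have yr n : nm (y n) <= r.
  elim: n => [|n IH] /=; first by rewrite nm0.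
  rewrite nmZr ger0_norm; last by rewrite /h; lra.
  have := nmD a (y n * y n); have := nmM (y n) (y n); have := nm_ge0 (y n).
  rewrite -/r /h; nra.
have sy n : star (y n) = y n.
  by elim: n => [|n IH] /=; rewrite ?star0// starZr starD starM !IH sa.
have ys n : nm (y n.+1 - y n) <= r ^+ n.
  elim: n => [|n IH]; first by rewrite /= mulr0 addr0 subr0 nmZr ger0_norm /h ?expr0; lra.
  have -> : y n.+2 - y n.+1
      = h%:C *: (y n.+1 * (y n.+1 - y n) + (y n.+1 - y n) * y n).
    by rewrite mulrBr mulrBl addrA subrK [y n.+2]/= {2}[y n.+1]/= -scalerBr opprD addrACA subrr add0r.
  rewrite nmZr ger0_norm; last by rewrite /h; lra.
  have := nmD (y n.+1 * (y n.+1 - y n)) ((y n.+1 - y n) * y n).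
  have := nmM (y n.+1) (y n.+1 - y n); have := nmM (y n.+1 - y n) (y n).
  have := yr n; have := yr n.+1; have := nm_ge0 (y n.+1 - y n).
  rewrite exprS /h; set u := nm (y n.+1 - y n) in IH *.
  have := nm_ge0 (y n.+1); have := nm_ge0 (y n).
  set v := nm (y n.+1 * _); set w := nm (_ * y n); set z := nm (_ + _).
  set p := nm (y n.+1); set q := nm (y n) => q0 p0 u0 pr qr hw hv hz.
  have qu : u * q <= r * r ^+ n by rewrite mulrC; apply: ler_pM.
  have pu : p * u <= r * r ^+ n by apply: ler_pM.
  lra.
pose t n := r ^+ n * (1 - r)^-1.
have yk n k : nm (y (n + k)%N - y n) <= t n - t (n + k)%N.
  elim: k => [|k IH]; first by rewrite addn0 !subrr nm0.
  rewrite addnS; have := nmD (y (n + k).+1 - y (n + k)%N) (y (n + k)%N - y n).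
  rewrite addrA subrK => /le_trans; apply.
  have -> : t n - t (n + k).+1 = r ^+ (n + k) + (t n - t (n + k)%N).
    by rewrite /t exprS; field; rewrite subr_eq0 gt_eqF.
  by apply: lerD.
have t0 n : 0 <= t n by rewrite /t mulr_ge0 ?exprn_ge0 ?invr_ge0 ?subr_ge0// ltW.
have [|m n nm|l hl] := @clim_complete y t.
- rewrite -[X in _ --> X](mul0r (1 - r)^-1); apply: cvgM; last exact: cvg_cst.
  by apply: cvg_expr; rewrite ger0_norm.
- by rewrite -(subnKC nm); apply: (le_trans (yk _ _)); rewrite gerBl t0.
have sl : star l = l.
  by apply: (clim_unique _ hl); move: (clim_star hl); under eq_fun do rewrite sy.
have el : l = h%:C *: (a + l * l).
  exact: (clim_unique (climS hl) (climZ _ (climD (clim_cst a) (climM hl hl)))).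
have hC : h%:C + h%:C = 1 by rewrite -rmorphD /= -mulr2n h2.
exists (1 - l); split.
- by rewrite starB star1 sl.
- have e2 : l + l = a + l * l by rewrite {1 2}el -scalerDl hC scale1r.
  have -> : a = l + l - l * l by rewrite e2 addrK.
  by rewrite mulrBr mulr1 mulrBl mul1r -addrA -opprD addrA.
- move=> b ab.
  have yb n : y n * b = b * y n.
    elim: n => [|n IH] /=; first by rewrite mul0r mulr0.
    by rewrite -scalerAl -scalerAr mulrDl mulrDr ab -mulrA IH mulrA IH mulrA.
  have lb : l * b = b * l.
    apply: (clim_unique (climM hl (clim_cst b))).
    by under eq_fun do rewrite yb; exact: climM (clim_cst b) hl.
  by rewrite mulrBl mulrBr lb mul1r mulr1.
Qed.
End Norm.

Section Morphism.
Context {R : realType} {A D : cstarAlgType R}.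

(** If [k] is hermitian with norm less than 1 and [y] is the square root of
    [1 - k ^ 2], then [f k + 'i *: f y] is unitary, and [f k] is half the sum of
    this unitary and its adjoint: hence [f k] has norm at most 1. *)
Lemma star_morphism_contractive (f : {lrmorphism A -> D}) :
  star_preserving f -> forall a, nm (f a) <= nm a.
Proof.
move=> fs.
have unit_herm (k : A) : star k = k -> nm k < 1 -> nm (f k) <= 1.
  move=> sk k1.
  have [||y [sy yy yc]] := @sqrt_one_sub R A (k * k).
  - by rewrite starM sk.
  - have := nmM k k; have := nm_ge0 k; nra.
  pose w : D := f k + 'i *: f y.
  have ky : k * y = y * k by rewrite yc// mulrA.
  have ww : star w * w = 1.
    rewrite /w starD starZ -!fs sk sy conjcE.
    rewrite mulrDl !mulrDr -!scalerAl -!scalerAr scalerA -!rmorphM yy ky.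
    have -> : ('i)^* * 'i = 1 :> R[i] by apply/eqP; rewrite eq_complex /=; apply/andP; split; apply/eqP; ring.
    rewrite scale1r rmorphB rmorph1.
    by rewrite conjc_i scaleNr addrA addrK addrC subrK.
  have w1 : nm w <= 1.
    have := nm_star_mul w; rewrite ww; have := @nm1_le R D; have := nm_ge0 w; nra.
  have -> : f k = (2^-1 : R)%:C *: (w + star w).
    rewrite /w starD starZ -!fs sk sy conjcE conjc_i.
    by rewrite scaleNr addrACA subrr addr0 scale_half.
  rewrite nmZr; have := nmD w (star w); rewrite nm_star ger0_norm; first by lra.
  by lra.
(* scaling by any number above [nm k] reduces to norm less than 1 *)
have herm (k : A) : star k = k -> nm (f k) <= nm k.
  move=> sk; apply/ler_addgt0Pr => e e0.
  have p0 : 0 < nm k + e by have := nm_ge0 k; lra.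
  have := unit_herm ((nm k + e)^-1%:C *: k); rewrite starZr sk => /(_ erefl).
  rewrite linearZ /= !nmZr ger0_norm ?invr_ge0 ?(ltW p0)//.
  by rewrite mulrC ltr_pdivrMr // mul1r ltrDl mulrC ler_pdivrMr// mul1r; apply.
move=> a; rewrite -(@ler_pXn2r _ 2) ?nnegrE ?nm_ge0//.
rewrite -!nm_star_mul -fs -rmorphM; apply: herm.
by rewrite starM starK.
Qed.
End Morphism.

(** * Complex scalars and Hilbert spaces *)

Section Modulus.
Context {R : realType}.
Local Notation C := R[i].
Implicit Types z w : C.

Definition cmod z : R := complex.Re `|z|.

Lemma cmodE z : `|z| = (cmod z)%:C.
Proof. by rewrite /cmod RRe_real // normr_real. Qed.

Lemma cmod_ge0 z : 0 <= cmod z.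
Proof. by rewrite -lecR -cmodE normr_ge0. Qed.

Lemma cmod_eq0 z : cmod z = 0 -> z = 0.
Proof. by move=> h; apply/normr0_eq0; rewrite cmodE h. Qed.

Lemma cmodD z w : cmod (z + w) <= cmod z + cmod w.
Proof. by rewrite -lecR rmorphD /= -!cmodE ler_normD. Qed.

Lemma cmodN z : cmod (- z) = cmod z.
Proof. by rewrite /cmod normrN. Qed.

Lemma cmodR (r : R) : cmod r%:C = `|r|.
Proof. by rewrite /cmod normc_def /= expr0n addr0 sqrtr_sqr. Qed.

Lemma cmod_sqr z : cmod z ^+ 2 = complex.Re z ^+ 2 + complex.Im z ^+ 2.
Proof. by apply: complexI; rewrite rmorphXn /= -cmodE -add_Re2_Im2. Qed.

Lemma cmod_Re z : `|complex.Re z| <= cmod z.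
Proof. by rewrite -lecR -cmodE normc_ge_Re. Qed.

Lemma ge0_ReP z : 0 <= z -> z = (complex.Re z)%:C /\ 0 <= complex.Re z.
Proof. by move=> z0; split; [rewrite RRe_real ?ger0_real|move: z0; rewrite lecE => /andP[]]. Qed.

Lemma conjMr (r : R) z : (r%:C * z)^* = r%:C * z^*.
Proof. by rewrite rmorphM /=; congr (_ * _); rewrite oppr0. Qed.

(** The 2 x 2 case of Cauchy-Schwarz: the entries of a positive form on [C^2]
    are automatically hermitian and have a nonnegative determinant. Every
    Cauchy-Schwarz inequality below is an instance. *)
Lemma psd2 (a b c d : C) :
  (forall s t : C, 0 <= s * s^* * a + s * t^* * b + s^* * t * c + t * t^* * d) ->
  c = b^* /\ cmod b ^+ 2 <= complex.Re a * complex.Re d.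
Proof.
case: a => a1 a2; case: b => b1 b2; case: c => c1 c2; case: d => d1 d2 h.
have {}h s1 s2 t1 t2 := h (s1 +i* s2) (t1 +i* t2).
have := h 1 0 0 0; rewrite lecE /= => /andP[/eqP A1 A2].
have := h 0 0 1 0; rewrite lecE /= => /andP[/eqP D1 D2].
have := h 1 0 1 0; rewrite lecE /= => /andP[/eqP B1 _].
have := h 1 0 0 1; rewrite lecE /= => /andP[/eqP B2 _].
have a20 : a2 = 0 by lra.
have d20 : d2 = 0 by lra.
have ec2 : c2 = - b2 by lra.
have ec1 : c1 = b1 by lra.
subst; split=> //; rewrite cmod_sqr /=.
have {}A2 : 0 <= a1 by lra.
have {}D2 : 0 <= d1 by lra.
set B := b1 ^+ 2 + b2 ^+ 2.
have B0 : 0 <= B by rewrite addr_ge0// sqr_ge0.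
(* take for [s] a real multiple of the conjugate of [b], and [t] real *)
have {}h k m : 0 <= k ^+ 2 * B * a1 - 2 * k * m * B + m ^+ 2 * d1.
  have := h (- k * b1) (k * b2) m 0; rewrite lecE /= => /andP[_ hh].
  by apply: (le_trans hh); rewrite le_eqVlt /B; apply/orP; left; apply/eqP; ring.
have [a0|a0] := eqVneq a1 0.
  have [->|Bn] := eqVneq B 0; first by rewrite mulr_ge0.
  have := h ((d1 + 1) / (2 * B)) 1; rewrite a0.
  have -> : ((d1 + 1) / (2 * B)) ^+ 2 * B * 0 - 2 * ((d1 + 1) / (2 * B)) * 1 * B
            + 1 ^+ 2 * d1 = -1.
    by field.
  by lra.
have a1p : 0 < a1 by rewrite lt_def a0.
have := h 1 a1; have -> : 1 ^+ 2 * B * a1 - 2 * 1 * a1 * B + a1 ^+ 2 * d1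
  = a1 * (a1 * d1 - B) by ring.
by rewrite pmulr_rge0// subr_ge0.
Qed.
End Modulus.

Section HilbertTheory.
Context {R : realType} {H : hilbertType R}.
Local Notation C := R[i].
Implicit Types x y z : H.

Lemma hdotC x y : hdot y x = (hdot x y)^* :> C.
Proof. by rewrite [LHS]hermC /= expr0 mul1r conjcE. Qed.

Lemma hdotDl x y z : hdot (x + y) z = hdot x z + hdot y z.
Proof. exact: linearDl. Qed.

Lemma hdotZl (c : C) x z : hdot (c *: x) z = c * hdot x z.
Proof. exact: linearZl_LR. Qed.

Lemma hdotDr x y z : hdot z (x + y) = hdot z x + hdot z y.
Proof. by rewrite hdotC hdotDl rmorphD /= -!hdotC. Qed.

Lemma hdotZr (c : C) x z : hdot z (c *: x) = c^* * hdot z x.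
Proof. by rewrite hdotC hdotZl rmorphM /= -hdotC. Qed.

Lemma hdot0l z : hdot 0 z = 0 :> C.
Proof. by rewrite -(scale0r (0 : H)) hdotZl mul0r. Qed.

Lemma hdotNl x z : hdot (- x) z = - hdot x z :> C.
Proof. by rewrite -scaleN1r hdotZl mulN1r. Qed.

Lemma hdotBl x y z : hdot (x - y) z = hdot x z - hdot y z :> C.
Proof. by rewrite hdotDl hdotNl. Qed.

Lemma hdot_suml I (s : seq I) (P : pred I) (F : I -> H) z :
  hdot (\sum_(i <- s | P i) F i) z = \sum_(i <- s | P i) hdot (F i) z :> C.
Proof. by apply: (big_morph (fun x => hdot x z)) => [x y|]; rewrite ?hdotDl ?hdot0l. Qed.

Lemma hdot_sumr I (s : seq I) (P : pred I) (F : I -> H) z :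
  hdot z (\sum_(i <- s | P i) F i) = \sum_(i <- s | P i) hdot z (F i) :> C.
Proof.
rewrite hdotC hdot_suml rmorph_sum /=; apply: eq_bigr => i _.
by rewrite -hdotC.
Qed.

Definition hnm x : R := complex.Re `|x|.

Lemma hnmE x : `|x| = (hnm x)%:C.
Proof. by rewrite /hnm RRe_real // ger0_real // normr_ge0. Qed.

Lemma hnm_ge0 x : 0 <= hnm x.
Proof. by rewrite -lecR -hnmE normr_ge0. Qed.

Lemma hnm_eq0 x : hnm x = 0 -> x = 0.
Proof. by move=> h; apply/normr0_eq0; rewrite hnmE h. Qed.

Lemma hnmD x y : hnm (x + y) <= hnm x + hnm y.
Proof. by rewrite -lecR rmorphD /= -!hnmE ler_normD. Qed.

Lemma hnmZ (c : C) x : hnm (c *: x) = cmod c * hnm x.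
Proof. by apply: complexI; rewrite rmorphM /= -cmodE -!hnmE normrZ. Qed.

Lemma hnmB x y : hnm (x - y) = hnm (y - x).
Proof. by rewrite /hnm distrC. Qed.

Lemma hdotxx x : hdot x x = (hnm x ^+ 2)%:C.
Proof. by rewrite -hdotE hnmE rmorphXn. Qed.

Lemma hdot_CS x y : cmod (hdot x y) <= hnm x * hnm y.
Proof.
have [|_] := @psd2 R (hdot x x) (hdot x y) (hdot y x) (hdot y y).
  move=> s t; have -> : s * s^* * hdot x x + s * t^* * hdot x y
      + s^* * t * hdot y x + t * t^* * hdot y y = hdot (s *: x + t *: y) (s *: x + t *: y).
    rewrite hdotDl !hdotDr !hdotZl !hdotZr; ring.
  by rewrite hdotxx ler0c sqr_ge0.
rewrite !hdotxx /= -exprMn ler_pXn2r ?nnegrE ?cmod_ge0//.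
by rewrite mulr_ge0 ?hnm_ge0.
Qed.

Lemma hdot_nondeg x y : (forall z, hdot x z = hdot y z) -> x = y.
Proof.
move=> h; apply/eqP; rewrite -subr_eq0; apply/eqP/hnm_eq0.
have : hdot (x - y) (x - y) = 0 by rewrite hdotBl h subrr.
by rewrite hdotxx => -[] /eqP; rewrite sqrf_eq0 => /eqP.
Qed.

Lemma hnm_le_dot x (M : R) : 0 <= M ->
  (forall z, cmod (hdot x z) <= M * hnm z) -> hnm x <= M.
Proof.
move=> M0 h; have := h x; rewrite hdotxx cmodR ger0_norm ?sqr_ge0//.
have := hnm_ge0 x; rewrite le_eqVlt => /predU1P[<-//|x0].
by rewrite expr2 ler_pM2r.
Qed.
End HilbertTheory.

(** * Positive kernels *)

Section Kernel.
Context {R : realType} {A : cstarAlgType R} {X : Type}.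
Local Notation C := R[i].
Implicit Types (a b : A) (x y : X) (c : C) (psi : A -> X -> X -> C).

(** The Stinespring form on formal sums of tensors [a (x) x]: the list [s] stands
    for the sum of [p.1 (x) p.2] over the entries [p] of [s]. *)
Definition kform psi (s t : seq (A * X)) : C :=
  \sum_(p <- s) \sum_(q <- t) psi (star q.1 * p.1) p.2 q.2.

(** A completely positive map [phi] into the operators on [H], seen through its
    matrix coefficients [psi a x y = <phi a x, y>]. Here [X] is a bare set of
    vectors, without linear structure: linearity in [x] and [y] is recovered from
    null vectors of the Stinespring form (see [kernel_linear]). *)
Definition pos_kernel psi : Prop :=
  (forall c a b x y, psi (c *: a + b) x y = c * psi a x y + psi b x y) /\
  (forall s, 0 <= kform psi s s).

Definition kscale c (s : seq (A * X)) := [seq (c *: p.1, p.2) | p <- s].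

Section Theory.
Variables (psi : A -> X -> X -> C) (psiP : pos_kernel psi).

Lemma kernelD a b x y : psi (a + b) x y = psi a x y + psi b x y.
Proof. by rewrite -{1}(scale1r a) psiP.1 mul1r. Qed.

Lemma kernel0 x y : psi 0 x y = 0.
Proof. by apply: (addrI (psi 0 x y)); rewrite -kernelD !addr0. Qed.

Lemma kernelZ c a x y : psi (c *: a) x y = c * psi a x y.
Proof. by rewrite -[c *: a]addr0 psiP.1 kernel0 addr0. Qed.

Lemma kernelN a x y : psi (- a) x y = - psi a x y.
Proof. by rewrite -scaleN1r kernelZ mulN1r. Qed.

Lemma kernelB a b x y : psi (a - b) x y = psi a x y - psi b x y.
Proof. by rewrite kernelD kernelN. Qed.

Lemma kform_catl s s' t : kform psi (s ++ s') t = kform psi s t + kform psi s' t.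
Proof. by rewrite /kform big_cat. Qed.

Lemma kform_catr s t t' : kform psi s (t ++ t') = kform psi s t + kform psi s t'.
Proof. by rewrite /kform -big_split /=; apply: eq_bigr => p _; rewrite big_cat. Qed.

Lemma kform_scalel c s t : kform psi (kscale c s) t = c * kform psi s t.
Proof.
rewrite /kform big_map big_distrr; apply: eq_bigr => p _ /=.
rewrite big_distrr; apply: eq_bigr => q _ /=.
by rewrite -scalerAr kernelZ.
Qed.

Lemma kform_scaler c s t : kform psi s (kscale c t) = c^* * kform psi s t.
Proof.
rewrite /kform big_distrr; apply: eq_bigr => p _ /=.
rewrite big_map big_distrr; apply: eq_bigr => q _ /=.
by rewrite starZ conjcE -scalerAl kernelZ.
Qed.

Lemma kform_CS s t : kform psi t s = (kform psi s t)^* /\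
  cmod (kform psi s t) ^+ 2
    <= complex.Re (kform psi s s) * complex.Re (kform psi t t).
Proof.
apply: psd2 => c d.
have -> : c * c^* * kform psi s s + c * d^* * kform psi s t
    + c^* * d * kform psi t s + d * d^* * kform psi t t
  = kform psi (kscale c s ++ kscale d t) (kscale c s ++ kscale d t).
  rewrite kform_catl !kform_catr !kform_scalel !kform_scaler; ring.
exact: psiP.2.
Qed.

Lemma kform1 a b x y : kform psi [:: (a, x)] [:: (b, y)] = psi (star b * a) x y.
Proof. by rewrite /kform !big_seq1. Qed.

Lemma kernel_star a x y : psi (star a) y x = (psi a x y)^*.
Proof.
have [+ _] := kform_CS [:: (a, x)] [:: (1, y)].
by rewrite !kform1 star1 mul1r mulr1.
Qed.

Lemma kernel_ge0 a x : 0 <= psi (star a * a) x x.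
Proof. by rewrite -kform1 psiP.2. Qed.

Lemma kernel_Re a x : psi (star a * a) x x = (complex.Re (psi (star a * a) x x))%:C.
Proof. by have [] := ge0_ReP (kernel_ge0 a x). Qed.

Lemma kernel1_ge0 x : 0 <= complex.Re (psi 1 x x).
Proof.
have := kernel_ge0 1 x; rewrite star1 mul1r.
by case/ge0_ReP.
Qed.

Lemma kernel_CS a b x y : cmod (psi (star b * a) x y) ^+ 2
  <= complex.Re (psi (star a * a) x x) * complex.Re (psi (star b * b) y y).
Proof. by have [_] := kform_CS [:: (a, x)] [:: (b, y)]; rewrite !kform1. Qed.

(** For [e > nm a] the element [e ^ 2 - star a * a] is a square, hence gives a
    nonnegative value; then let [e] tend to [nm a]. *)
Lemma kernel_contractive a x :
  complex.Re (psi (star a * a) x x) <= nm a ^+ 2 * complex.Re (psi 1 x x).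
Proof.
suff h (e : R) : nm a < e ->
    complex.Re (psi (star a * a) x x) <= e ^+ 2 * complex.Re (psi 1 x x).
  have lim : (fun n => (nm a + harmonic n) ^+ 2 * complex.Re (psi 1 x x)) @ \oo
      --> (nm a + 0) ^+ 2 * complex.Re (psi 1 x x).
    apply: cvgM; last exact: cvg_cst.
    by apply: cvgM; apply: cvgD; (exact: cvg_cst || exact: cvg_harmonic).
  rewrite addr0 in lim; apply: (ler_cvg_to (cvg_cst _) lim); apply: nearW => n.
  by apply: h; rewrite ltrDl invr_gt0.
move=> ae; have e0 : 0 < e by have := nm_ge0 a; lra.
have [||y [sy yy _]] := @sqrt_one_sub R A ((e ^- 2)%:C *: (star a * a)).
- by rewrite starZr starM starK.
- rewrite nmZr nm_star_mul ger0_norm ?invr_ge0 ?sqr_ge0//.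
  rewrite mulrC ltr_pdivrMr ?exprn_gt0// mul1r ltr_pXn2r ?nnegrE ?nm_ge0//.
  exact: ltW.
have := kernel_ge0 y x; rewrite sy yy kernelB kernelZ kernel_Re.
rewrite lecE /= => /andP[_].
rewrite -rmorphM raddfB /= subr_ge0 mulrC ler_pdivrMr ?exprn_gt0//.
by rewrite mulrC.
Qed.

Lemma kernel_bounded x y : exists K : R, forall a, cmod (psi a x y) <= K * nm a.
Proof.
pose k := Num.sqrt (complex.Re (psi 1 x x) * complex.Re (psi 1 y y)).
exists k => a.
rewrite -(@ler_pXn2r _ 2) ?nnegrE ?cmod_ge0// ?mulr_ge0 ?nm_ge0 ?sqrtr_ge0//.
rewrite exprMn sqr_sqrtr; last by rewrite mulr_ge0// kernel1_ge0.
have := kernel_CS a 1 x y; rewrite star1 !mul1r => /le_trans; apply.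
rewrite mulrAC; apply: ler_wpM2r; first exact: kernel1_ge0.
by rewrite mulrC kernel_contractive.
Qed.

(** A null vector of a positive form is orthogonal to everything. *)
Lemma kform_null s t : kform psi s s = 0 -> kform psi s t = 0.
Proof.
move=> s0; have [_] := kform_CS s t; rewrite s0 mul0r => h.
by apply: cmod_eq0; apply/eqP; rewrite -sqrf_eq0 eq_le h sqr_ge0.
Qed.
End Theory.
End Kernel.

Section HilbertKernel.
Context {R : realType} {A : cstarAlgType R} {H : hilbertType R}.
Local Notation C := R[i].
Variables (psi : A -> H -> H -> C) (psiP : pos_kernel psi).
Hypothesis psi1 : forall x y, psi 1 x y = hdot x y.

Lemma kernel_le a x y : cmod (psi a x y) <= nm a * (hnm x * hnm y).
Proof.
rewrite -(@ler_pXn2r _ 2) ?nnegrE ?cmod_ge0// ?mulr_ge0 ?nm_ge0 ?hnm_ge0//.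
have := kernel_CS psiP a 1 x y; rewrite star1 !mul1r => /le_trans; apply.
have := kernel_contractive psiP a x; rewrite !psi1 !hdotxx /= => h.
by rewrite !exprMn mulrA; apply: ler_wpM2r => //; exact: sqr_ge0.
Qed.

(** Choi's multiplicative domain: the two hypotheses say that
    [a (x) x - 1 (x) f x] is a null vector of the Stinespring form, and the
    conclusion is its orthogonality to [star b (x) y]. *)
Lemma multiplicative_domain (a : A) (f : H -> H) :
    (forall x y, psi a x y = hdot (f x) y) ->
    (forall x, psi (star a * a) x x = hdot (f x) (f x)) ->
  forall b x y, psi (b * a) x y = psi b (f x) y.
Proof.
move=> ha haa b x y.
pose s : seq (A * H) := [:: (a, x); (- 1, f x)].
have := @kform_null _ _ _ _ psiP s [:: (star b, y)].
rewrite /kform /s !big_cons !big_nil /= !addr0 starK starN star1 !mulN1r !mulrN1.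
rewrite opprK !(kernelN psiP) psi1 haa ha (kernel_star psiP) ha -hdotC.
rewrite subrr add0r addNr => /(_ erefl) /eqP.
by rewrite subr_eq0 => /eqP.
Qed.
End HilbertKernel.

(** * Extension of positive functionals *)

Section PositiveExtension.
Context {R : realType} {V : lmodType R[i]}.
Variables (K : set V) (G0 : set (V * R)).
Hypothesis KD : forall v w, K v -> K w -> K (v + w).
Hypothesis KZ : forall (r : R) v, 0 <= r -> K v -> K (r%:C *: v).

(** Partial functionals are given by their graphs, so that the union of a chain
    of extensions needs no construction. *)
Definition real_linear_graph (G : set (V * R)) :=
  forall (r : R) v w a b, G (v, a) -> G (w, b) -> G (r%:C *: v + w, r * a + b).

Definition positive_graph (G : set (V * R)) := forall v a, G (v, a) -> K v -> 0 <= a.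

Hypothesis G00 : G0 (0, 0).
Hypothesis G0l : real_linear_graph G0.
Hypothesis G0p : positive_graph G0.

(** M. Riesz's extension theorem. A maximal positive graph [Gt] is defined at
    every [v] that lies between two elements of its domain: the admissible values
    at [v] form the gap between the values on the elements below [v] and those on
    the elements above [v], and any value [alpha] in the gap extends [Gt]. The
    graph [G0] is adjoined to the members of the chain, so that the empty chain
    needs no separate treatment. *)
Lemma positive_extension : exists G : set (V * R),
  [/\ G0 `<=` G, real_linear_graph G, positive_graph G
    & forall v, (exists w a, G0 (w, a) /\ K (w - v)) ->
                (exists w a, G0 (w, a) /\ K (v - w)) -> exists a, G (v, a)].
Proof.
pose P (G : set (V * R)) := real_linear_graph (G `|` G0) /\ positive_graph (G `|` G0).
have [F FP tot|G [[Gl Gp] Gmax]] := @Zorn_bigcup _ P.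
  split.
  - move=> r v w a b [[X FX Xv]|v0] [[Y FY Yw]|w0].
    + have [XY|YX] := tot _ _ FX FY.
        have [Yl _] := FP _ FY.
        have [?|?] := Yl r v w a b (or_introl (XY _ Xv)) (or_introl Yw); [left; exists Y|right] => //.
      have [Xl _] := FP _ FX.
      have [?|?] := Xl r v w a b (or_introl Xv) (or_introl (YX _ Yw)); [left; exists X|right] => //.
    + have [Xl _] := FP _ FX.
      have [?|?] := Xl r v w a b (or_introl Xv) (or_intror w0); [left; exists X|right] => //.
    + have [Yl _] := FP _ FY.
      have [?|?] := Yl r v w a b (or_intror v0) (or_introl Yw); [left; exists Y|right] => //.
    + by right; exact: G0l.
  - move=> v a [[X FX Xv]|v0]; last exact: G0p v0.
    by have [_ Xp] := FP _ FX; apply: Xp; left.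
set Gt := G `|` G0 in Gl Gp.
have Gt0 : Gt (0, 0) by right.
have GtZ r v a : Gt (v, a) -> Gt (r%:C *: v, r * a).
  by move=> /(Gl r) => /(_ _ _ Gt0); rewrite !addr0.
have GtN v a : Gt (v, a) -> Gt (- v, - a).
  by move=> /(GtZ (-1)); rewrite rmorphN1 scaleN1r mulN1r.
have GtD v w a b : Gt (v, a) -> Gt (w, b) -> Gt (v + w, a + b).
  by move=> /(Gl 1)/[apply]; rewrite rmorph1 scale1r mul1r.
exists Gt; split=> // [p ?|v [u [au [Gu Ku]]] [l [al [Gll Kl]]]]; first by right.
pose L := [set b | exists w, Gt (w, b) /\ K (v - w)].
have Lub b w c : L b -> Gt (w, c) -> K (w - v) -> b <= c.
  move=> [z [Gz Kz]] Gw Kw; rewrite -subr_ge0.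
  apply: (Gp (w - z)); first exact: GtD (GtN _ _ Gz).
  by rewrite -(subrK v w) -addrA; exact: KD.
have L0 : L al by exists l; split=> //; right.
have hasL : has_sup L.
  split; first by exists al.
  by exists au => b Lb; apply: (Lub _ u) => //; right.
pose alpha := sup L.
have alphaL b : L b -> b <= alpha by move=> Lb; exact: ub_le_sup hasL.2 _ Lb.
have alphaU w c : Gt (w, c) -> K (w - v) -> alpha <= c.
  move=> Gw Kw; apply: sup_le_ub => [|b Lb]; first by exists al.
  exact: Lub Lb Gw Kw.
pose G' : set (V * R) := [set p | exists w b (c : R),
  Gt (w, b) /\ p = (w + c%:C *: v, b + c * alpha)].
have GG' : Gt `<=` G'.
  by move=> [w b] Gw; exists w, b, 0; rewrite rmorph0 scale0r mul0r !addr0.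
have G'0 : G' `|` G0 = G'.
  by apply/seteqP; split=> p; [case=> // ?; apply: GG'; right|left].
have PG' : P G'.
  rewrite /P G'0; split.
  - move=> r _ _ _ _ [w [b [c [Gw [-> ->]]]]] [w' [b' [c' [Gw' [-> ->]]]]].
    exists (r%:C *: w + w'), (r * b + b'), (r * c + c'); split; first exact: Gl.
    congr (_, _); last by ring.
    rewrite rmorphD rmorphM /= scalerDr scalerDl scalerA.
    by rewrite addrACA.
  - move=> _ _ [w [b [c [Gw [-> ->]]]]] Kv.
    have [c0|c0|c0] := ltgtP c 0.
    + have : alpha <= (- c)^-1 * b.
        apply: (alphaU ((- c)^-1%:C *: w)); first exact: GtZ.
        have -> : (- c)^-1%:C *: w - v = (- c)^-1%:C *: (w + c%:C *: v).
          rewrite scalerDr scalerA -rmorphM /=.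
          by rewrite invrN mulNr mulVf ?lt_eqF// rmorphN1 scaleN1r.
        by apply: KZ => //; rewrite invr_ge0 oppr_ge0 ltW.
      by rewrite mulrC ler_pdivlMr ?oppr_gt0//; lra.
    + have : - (c^-1 * b) <= alpha.
        apply: alphaL; exists (- (c^-1%:C *: w)); split; first exact/GtN/GtZ.
        have -> : v - - (c^-1%:C *: w) = c^-1%:C *: (w + c%:C *: v).
          by rewrite opprK scalerDr scalerA -rmorphM /= mulVf ?gt_eqF// rmorph1 scale1r addrC.
        by apply: KZ => //; rewrite invr_ge0 ltW.
      by rewrite mulrC -mulNr ler_pdivrMr//; lra.
    + move: Kv; rewrite c0 rmorph0 scale0r mul0r !addr0.
      exact: Gp.
exists alpha; left.
have : ~ G `<` G' by move=> /Gmax.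
rewrite properEneq => /not_andP[/negP|]; last first.
  by case; apply: subset_trans GG'; left.
rewrite negbK => /eqP ->; exists 0, 0, 1.
by rewrite rmorph1 scale1r mul1r !add0r.
Qed.
End PositiveExtension.

(** * Arveson's extension theorem for kernels *)

Section Arveson.
Context {R : realType} {A : cstarAlgType R} {X : eqType}.
Local Notation C := R[i].
Local Notation V := (X -> X -> A).
Implicit Types (v w : V) (s : seq X).

Lemma fctD2 v w x y : (v + w) x y = v x y + w x y. Proof. by []. Qed.
Lemma fctN2 v x y : (- v) x y = - v x y. Proof. by []. Qed.
Lemma fctZ2 (c : C) v x y : (c *: v) x y = c *: v x y. Proof. by []. Qed.
Lemma fct_sum2 I (r : seq I) (P : pred I) (F : I -> V) x y :
  (\sum_(i <- r | P i) F i) x y = \sum_(i <- r | P i) F i x y.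
Proof. by rewrite !fct_sumE. Qed.

(** Elements of [V] are matrices over [A] indexed by [X]; this is the adjoint. *)
Definition kadj v : V := fun x y => star (v y x).

Definition supported s v := forall x y, ~~ ((x \in s) && (y \in s)) -> v x y = 0.

Definition rank1 (c : X -> A) : V := fun x y => star (c x) * c y.

(** The positive matrices of finite support. Only sums of squares occur, of any
    number of terms, so that closure under addition is immediate. *)
Definition kcone : set V := [set v | exists s n (c : nat -> X -> A),
  (forall k x, x \notin s -> c k x = 0) /\ v = \sum_(k < n) rank1 (c k)].

Definition matrix_unit (a : A) (x y : X) : V :=
  fun x' y' => if (x' == x) && (y' == y) then a else 0.

Lemma kcone0 : kcone 0.
Proof. by exists [::], 0%N, (fun _ _ => 0); rewrite big_ord0. Qed.

Lemma kconeD v w : kcone v -> kcone w -> kcone (v + w).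
Proof.
move=> [s [n [c [hc ->]]]] [t [m [d [hd ->]]]].
exists (s ++ t), (n + m)%N, (fun k => if (k < n)%N then c k else d (k - n)%N); split.
  by move=> k x; rewrite mem_cat negb_or => /andP[xs xt]; case: ifP => _; [apply: hc|apply: hd].
rewrite big_split_ord /=; congr (_ + _); apply: eq_bigr => k _.
  by rewrite ltn_ord.
by rewrite ltnNge leq_addr /= addKn.
Qed.

Lemma kconeZ (r : R) v : 0 <= r -> kcone v -> kcone (r%:C *: v).
Proof.
move=> r0 [s [n [c [hc ->]]]].
exists s, n, (fun k x => (Num.sqrt r)%:C *: c k x); split.
  by move=> k x /hc ->; rewrite scaler0.
rewrite scaler_sumr; apply: eq_bigr => k _.
apply/funext => x; apply/funext => y.
by rewrite fctZ2 /rank1 starZr -scalerAl -scalerAr scalerA -rmorphM /= -expr2 sqr_sqrtr.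
Qed.

Lemma kcone_rank1 s (c : X -> A) : (forall x, x \notin s -> c x = 0) -> kcone (rank1 c).
Proof. by move=> h; exists s, 1%N, (fun=> c); rewrite big_ord1. Qed.

Variables (S : set A) (theta : A -> X -> X -> C).
Hypothesis opS : operator_system S.
Hypothesis thetaL : forall c a b x y, S a -> S b ->
  theta (c *: a + b) x y = c * theta a x y + theta b x y.
Hypothesis thetaP : forall n (Y : 'M[A]_n) (xi : 'I_n -> X),
  (forall k l, S ((starmx Y *m Y) k l)) ->
  0 <= \sum_k \sum_l theta ((starmx Y *m Y) k l) (xi l) (xi k).

Lemma opS0 : S 0.
Proof. by case: opS => S1 Sl _; rewrite -(subrr 1) -scaleN1r addrC; exact: Sl. Qed.

Lemma opSZ c a : S a -> S (c *: a).
Proof. by case: opS => _ Sl _ Sa; rewrite -[_ *: _]addr0; apply: Sl => //; exact: opS0. Qed.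

Lemma opSD a b : S a -> S b -> S (a + b).
Proof. by case: opS => _ Sl _ Sa Sb; rewrite -(scale1r a); apply: Sl. Qed.

Lemma opSB a b : S a -> S b -> S (a - b).
Proof. by case: opS => _ Sl _ Sa Sb; rewrite addrC -scaleN1r; exact: Sl. Qed.

Lemma theta0 x y : theta 0 x y = 0.
Proof.
have := @thetaL 1 0 0 x y opS0 opS0; rewrite scaler0 addr0 mul1r.
by move/eqP; rewrite -subr_eq0 opprD addrA subrr add0r oppr_eq0 => /eqP.
Qed.

Lemma thetaZ c a x y : S a -> theta (c *: a) x y = c * theta a x y.
Proof. by move=> Sa; rewrite -[c *: a]addr0 thetaL ?theta0 ?addr0//; exact: opS0. Qed.

(** When [nm d < 1], the matrix with rows [1, d] and [star d, 1] is positive, by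
    the square root of [1 - star d * d]. That the form is real on it for [d = b]
    and for [d = 'i *: b] gives the hermitian symmetry. *)
Lemma theta_star a x y : S a -> theta (star a) x y = (theta a y x)^*.
Proof.
have [S1 Sl Sst] := opS.
suff small b : S b -> nm b < 1 -> theta (star b) x y = (theta b y x)^*.
  move=> Sa; pose r := nm a + 1.
  have r0 : 0 < r by rewrite /r; have := nm_ge0 a; lra.
  have rn0 : r%:C != 0 :> C by rewrite fmorph_eq0 gt_eqF.
  have /(_ (opSZ _ Sa)) := @small (r^-1%:C *: a).
  have -> : nm (r^-1%:C *: a) < 1.
    by rewrite nmZr ger0_norm ?invr_ge0 ?ltW// mulrC ltr_pdivrMr// mul1r /r ltrDl.
  move=> /(_ isT); rewrite starZr !thetaZ//; last exact: Sst.
  rewrite conjMr => /mulfI; apply.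
  by rewrite fmorph_eq0 invr_eq0 gt_eqF.
move=> Sb b1.
have key (d : A) : S d -> nm d < 1 ->
    0 <= theta 1 x x + theta d y x + (theta (star d) x y + theta 1 y y).
  move=> Sd d1.
  have [||z [sz zz _]] := @sqrt_one_sub R A (star d * d).
  - by rewrite starM starK.
  - by rewrite nm_star_mul expr_lt1 ?nm_ge0.
  pose Y : 'M[A]_2 := \matrix_(i, k)
     if i == ord0 then (if k == ord0 then 1 else d) else (if k == ord0 then 0 else z).
  pose xi (k : 'I_2) := if k == ord0 then x else y.
  have e k l : (starmx Y *m Y) k l = star (Y ord0 k) * Y ord0 l
      + star (Y (lift ord0 ord0) k) * Y (lift ord0 ord0) l.
    by rewrite mxE !big_ord_recl big_ord0 addr0 !mxE.
  have E : (forall k l, (starmx Y *m Y) k l =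
     if k == ord0 then (if l == ord0 then 1 else d)
     else (if l == ord0 then star d else 1)).
    move=> k l; rewrite e !mxE /=.
    case: (k == ord0); case: (l == ord0); rewrite ?star1 ?star0 ?mul1r ?mul0r ?mulr0 ?addr0 ?mulr1//.
    by rewrite sz zz addrC subrK.
  have := @thetaP 2 Y xi; rewrite !big_ord_recl !big_ord0 !E /xi /= !addr0.
  apply => k l; rewrite E; case: (k == ord0); case: (l == ord0) => //; exact: Sst.
have := key b Sb b1; have := key ('i *: b).
rewrite nmZ.
have -> : `|'i| = 1 :> C by rewrite normc_def /= expr0n expr1n add0r sqrtr1.
rewrite /= mul1r starZ conjcE => /(_ (opSZ _ Sb) b1).
rewrite !thetaZ//; last exact: Sst.
have := key 0; rewrite nm0 star0 !theta0 => /(_ opS0 ltr01).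
case: (theta 1 x x) => p1 p2; case: (theta 1 y y) => q1 q2.
case: (theta b y x) => t1 t2; case: (theta (star b) x y) => u1 u2.
rewrite !lecE /= => /andP[/eqP h1 _] /andP[/eqP h2 _] /andP[/eqP h3 _].
by congr (_ +i* _); lra.
Qed.

(** The linear functional that [theta] induces on matrices; [s] is any
    duplicate-free list that contains the support. *)
Definition ksum s v : C := \sum_(x <- s) \sum_(y <- s) theta (v x y) y x.

Definition Sval v := forall x y, S (v x y).

Lemma sum_sub_uniq s t (f : X -> C) : uniq s -> uniq t -> {subset s <= t} ->
  (forall x, x \notin s -> f x = 0) -> \sum_(x <- t) f x = \sum_(x <- s) f x.
Proof.
move=> us ut st f0; rewrite (bigID (mem s)) /= [X in _ + X]big1 ?addr0; last by move=> x /f0.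
rewrite -big_filter; apply: perm_big; apply: uniq_perm => //; first exact: filter_uniq.
by move=> x; rewrite mem_filter; case xs: (x \in s); rewrite //= st.
Qed.

Lemma ksum_sub s t v : uniq s -> uniq t -> {subset s <= t} -> supported s v ->
  ksum t v = ksum s v.
Proof.
move=> us ut st sv; rewrite /ksum (sum_sub_uniq us ut st).
  apply: eq_bigr => x _; apply: (sum_sub_uniq us ut st) => y ys.
  by rewrite sv ?theta0// (negbTE ys) andbF.
by move=> x xs; rewrite big1// => y _; rewrite sv ?theta0// (negbTE xs).
Qed.

Lemma ksum_lin s (c : C) v w : Sval v -> Sval w ->
  ksum s (c *: v + w) = c * ksum s v + ksum s w.
Proof.
move=> Sv Sw; rewrite /ksum big_distrr -big_split; apply: eq_bigr => x _ /=.
rewrite big_distrr -big_split; apply: eq_bigr => y _ /=.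
by rewrite thetaL.
Qed.

Lemma ksum_adj s v : Sval v -> ksum s (kadj v) = (ksum s v)^*.
Proof.
move=> Sv; rewrite /ksum rmorph_sum /= exchange_big; apply: eq_bigr => x _ /=.
rewrite rmorph_sum; apply: eq_bigr => y _ /=.
by rewrite /kadj theta_star.
Qed.

(** The hypothesis on [theta] concerns squares of square matrices: the family [c]
    of rows and the enumeration [s'] of the support are both padded to the length
    [N]. *)
Lemma ksum_pos s v : uniq s -> Sval v -> supported s v -> kcone v -> 0 <= ksum s v.
Proof.
move=> us Sv sv [t [n [c [hc ev]]]].
pose s' := undup (s ++ t).
have us' : uniq s' by rewrite undup_uniq.
have ss' : {subset s <= s'} by move=> x xs; rewrite mem_undup mem_cat xs.
rewrite -(ksum_sub us us' ss' sv).
case Es : s' => [|x0 s0]; first by rewrite /ksum big_nil.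
rewrite -Es.
pose q := size s'; pose N := maxn q n.
pose Y : 'M[A]_N := \matrix_(i, k)
   if (i < n)%N && (k < q)%N then c i (nth x0 s' k) else 0.
have YE k l : (starmx Y *m Y) k l =
    if (k < q)%N && (l < q)%N then v (nth x0 s' k) (nth x0 s' l) else 0.
  rewrite mxE ev fct_sum2.
  under eq_bigr do rewrite !mxE.
  rewrite (big_ord_widen N (fun i => rank1 (c i) (nth x0 s' k) (nth x0 s' l))) ?leq_maxr//.
  case: ifP => [/andP[-> ->]|/negbT /nandP kl]; last first.
    apply: big1 => i _.
    by case: kl => /negbTE ->; rewrite !andbF ?star0 ?mul0r ?mulr0.
  rewrite [RHS]big_mkcond; apply: eq_bigr => i _; rewrite !andbT /rank1.
  by case: ifP => _ //; rewrite star0 mul0r.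
have := @thetaP N Y (fun k => nth x0 s' k).
have -> : \sum_k \sum_l theta ((starmx Y *m Y) k l) (nth x0 s' l) (nth x0 s' k) = ksum s' v.
  have wid (f : nat -> C) : \sum_(k < q) f k = \sum_(k < N) (if (k < q)%N then f k else 0).
    by rewrite (big_ord_widen N f) ?leq_maxl// big_mkcond.
  rewrite /ksum (big_nth x0) big_mkord.
  rewrite (wid (fun k => \sum_(y <- s') theta (v (nth x0 s' k) y) y (nth x0 s' k))).
  apply: eq_bigr => k _; symmetry.
  case: ifP => kq; last by symmetry; apply: big1 => l _; rewrite YE kq theta0.
  rewrite (big_nth x0) big_mkord.
  rewrite (wid (fun l => theta (v (nth x0 s' k) (nth x0 s' l)) (nth x0 s' l) (nth x0 s' k))).
  apply: eq_bigr => l _.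
  by rewrite YE kq /=; case: ifP => // _; rewrite theta0.
apply=> k l; rewrite YE; case: ifP => _; [exact: Sv|exact: opS0].
Qed.

(** [v] belongs to it when its hermitian part is positive. Skew matrices belong to
    it together with their opposites, so that a real functional that is positive
    on it vanishes on them. *)
Definition kcone_real : set V := [set v | kcone (v + kadj v)].

Definition theta_graph : set (V * R) := [set p | exists s,
  [/\ uniq s, supported s p.1, Sval p.1 & p.2 = complex.Re (ksum s p.1)]].

Lemma kadjD v w : kadj (v + w) = kadj v + kadj w.
Proof. by apply/funext => x; apply/funext => y; rewrite /kadj !fctD2 starD. Qed.

Lemma kadjZ c v : kadj (c *: v) = c^* *: kadj v.
Proof. by apply/funext => x; apply/funext => y; rewrite /kadj !fctZ2 starZ conjcE. Qed.

Lemma kadjZr (r : R) v : kadj (r%:C *: v) = r%:C *: kadj v.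
Proof. by apply/funext => x; apply/funext => y; rewrite /kadj !fctZ2 starZr. Qed.

Lemma kadjN v : kadj (- v) = - kadj v.
Proof. by apply/funext => x; apply/funext => y; rewrite /kadj !fctN2 starN. Qed.

Lemma kadj_elem a x y : kadj (matrix_unit a x y) = matrix_unit (star a) y x.
Proof.
apply/funext => x'; apply/funext => y'; rewrite /kadj /matrix_unit andbC.
by case: ifP => // _; rewrite star0.
Qed.

Lemma kadj_rank1 c : kadj (rank1 c) = rank1 c.
Proof. by apply/funext => x; apply/funext => y; rewrite /kadj /rank1 starM starK. Qed.

Lemma ksum_elem s a x y : uniq s -> x \in s -> y \in s ->
  ksum s (matrix_unit a x y) = theta a y x.
Proof.
move=> us xs ys; rewrite /ksum (bigD1_seq x xs us) (bigD1_seq y ys us).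
have e x' y' : matrix_unit a x y x' y' = if (x' == x) && (y' == y) then a else 0 by [].
rewrite /= big1 => [|i /negbTE ix]; last by rewrite e eqxx ix theta0.
rewrite big1 => [|i /negbTE ix]; last by apply: big1 => j _; rewrite e ix theta0.
by rewrite e !eqxx !addr0.
Qed.

Lemma theta_graph_elem a x y : S a ->
  theta_graph (matrix_unit a x y, complex.Re (theta a y x)).
Proof.
move=> Sa; exists (undup [:: x; y]); rewrite undup_uniq; split=> //.
- move=> x' y'; rewrite !mem_undup !inE /= /matrix_unit; case: ifP => // /andP[/eqP -> /eqP ->].
  by rewrite !eqxx orbT.
- by move=> x' y'; rewrite /= /matrix_unit; case: ifP => // _; exact: opS0.
- by rewrite ksum_elem ?undup_uniq// !mem_undup !inE eqxx ?orbT.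
Qed.

Lemma supported_sub s t v : {subset s <= t} -> supported s v -> supported t v.
Proof.
move=> st sv x y h; apply: sv; apply: contra h => /andP[/st -> /st ->] //.
Qed.

Lemma theta_graph_linear : real_linear_graph theta_graph.
Proof.
move=> r v w a b [s [/= us sv Sv ->]] [t [/= ut tw Sw ->]].
pose s' := undup (s ++ t); have us' : uniq s' by rewrite undup_uniq.
have ss' : {subset s <= s'} by move=> x xs; rewrite mem_undup mem_cat xs.
have ts' : {subset t <= s'} by move=> x xs; rewrite mem_undup mem_cat xs orbT.
exists s'; split=> //=.
- move=> x y h; rewrite fctD2 fctZ2 (supported_sub ss' sv)// (supported_sub ts' tw)//.
  by rewrite scaler0 addr0.
- by move=> x y; rewrite fctD2 fctZ2; apply: opSD => //; exact: opSZ.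
- rewrite ksum_lin// (ksum_sub us us' ss' sv) (ksum_sub ut us' ts' tw).
  by case: (ksum s v) => p q; case: (ksum t w) => p' q' /=; ring.
Qed.

Lemma theta_graph_pos : positive_graph kcone_real theta_graph.
Proof.
move=> v a [s [/= us sv Sv ->]] Kv.
have [S1 Sl Sst] := opS.
have Sa : Sval (kadj v) by move=> x y; exact: Sst.
have := @ksum_pos s (v + kadj v) us.
have -> : ksum s (v + kadj v) = ksum s v + (ksum s v)^*.
  by rewrite -{1}(scale1r v) ksum_lin// mul1r ksum_adj.
case: (ksum s v) => p q h.
have /h : Sval (v + kadj v) by move=> x y; exact: opSD.
have sv' : supported s (v + kadj v).
  move=> x y h'; rewrite fctD2 /kadj sv// sv ?star0 ?addr0//.
  by rewrite andbC.
move=> /(_ sv' Kv); rewrite lecE /= => /andP[_]; lra.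
Qed.

(** The square of [1] at [x] and [- a] at [y] has [- a] and [- star a] off the
    diagonal, and [star a * a] on it, which is below a scalar: twice the hermitian
    part of [matrix_unit a x y] is below a diagonal matrix with scalar entries. *)
Lemma elem_cofinal a x y : exists w r, theta_graph (w, r) /\ kcone_real (w - matrix_unit a x y).
Proof.
have [S1 Sl Sst] := opS.
pose m := nm a ^+ 2 + 1.
have m0 : 0 < m by rewrite /m; have := sqr_ge0 (nm a); lra.
have [||z [sz zz _]] := @sqrt_one_sub R A (m^-1%:C *: (star a * a)).
- by rewrite starZr starM starK.
- rewrite nmZr nm_star_mul ger0_norm ?invr_ge0 ?ltW//.
  by rewrite mulrC ltr_pdivrMr// mul1r /m ltrDl.
pose w : V := (2^-1 : R)%:C *: (matrix_unit 1 x x + matrix_unit m%:C%:A y y).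
have Gw : exists r, theta_graph (w, r).
  have g1 := theta_graph_elem x x S1.
  have g2 := theta_graph_elem y y (opSZ m%:C S1).
  have g0 : theta_graph (0, 0).
    by exists [::]; split=> //=; [move=> *; exact: opS0|rewrite /ksum big_nil].
  have := theta_graph_linear (2^-1) (theta_graph_linear 1 g1 g2) g0.
  by rewrite rmorph1 scale1r addr0 => g; eexists; exact: g.
have [r Gr] := Gw; exists w, r; split=> //.
pose c1 : X -> A := fun t => (if t == x then 1 else 0) - (if t == y then a else 0).
pose c2 : X -> A := fun t => if t == y then (Num.sqrt m)%:C *: z else 0.
rewrite /kcone_real /=.
have -> : w - matrix_unit a x y + kadj (w - matrix_unit a x y) = rank1 c1 + rank1 c2.
  have wadj : kadj w = w.
    by rewrite /w kadjZr kadjD !kadj_elem starZr star1.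
  have ww : w + w = matrix_unit 1 x x + matrix_unit m%:C%:A y y.
    by rewrite /w -scalerDr scale_half.
  rewrite kadjD kadjN wadj kadj_elem addrACA ww.
  apply/funext => x'; apply/funext => y'.
  rewrite !fctD2 !fctN2 /rank1 /c1 /c2 /matrix_unit.
  have m1 : (m%:C)^-1 * m%:C = 1 :> C by rewrite mulVf// fmorph_eq0 gt_eqF.
  have e : star ((Num.sqrt m)%:C *: z) * ((Num.sqrt m)%:C *: z) = m%:C%:A - star a * a.
    rewrite starZr sz -scalerAl -scalerAr scalerA -rmorphM /= -expr2 sqr_sqrtr ?ltW//.
    rewrite zz scalerBr scalerA -rmorphM /= mulfV ?gt_eqF//.
    by rewrite rmorph1 scale1r.
  have cancel (p q t : A) : p + q + (t - q) = p + t by rewrite [t - q]addrC addrA addrK.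
  case: (x' == x); case: (x' == y); case: (y' == x); case: (y' == y);
    rewrite /= ?e ?starB ?star1 ?star0 ?mulrBl ?mulrBr ?mul0r ?mulr0 ?mul1r ?mulr1 ?subr0 ?sub0r ?addr0 ?add0r ?oppr0 ?opprK ?opprB ?mulNr ?mulrN ?opprK//.
  all: try by rewrite ?addr0 ?add0r ?subr0 ?opprK ?subrr.
  - by rewrite [star a * a - star a]addrC [1 - a + _]addrA cancel addrAC addrA.
  - by rewrite cancel addrC.
  - by rewrite [star a * a - star a]addrC cancel add0r addrC.
  - by rewrite addrCA subrr addr0.
apply: kconeD.
  apply: (@kcone_rank1 [:: x; y]) => t; rewrite !inE negb_or /c1 => /andP[/negbTE -> /negbTE ->].
  by rewrite subr0.
by apply: (@kcone_rank1 [:: y]) => t; rewrite !inE /c2 => /negbTE ->.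
Qed.

Lemma kcone_realD v w : kcone_real v -> kcone_real w -> kcone_real (v + w).
Proof. by rewrite /kcone_real /= kadjD addrACA; exact: kconeD. Qed.

Lemma kcone_realZ (r : R) v : 0 <= r -> kcone_real v -> kcone_real (r%:C *: v).
Proof. by rewrite /kcone_real /= kadjZr -scalerDr; exact: kconeZ. Qed.

Lemma kcone_real_skew v : kadj v = - v -> kcone_real v.
Proof. by move=> h; rewrite /kcone_real /= h subrr; exact: kcone0. Qed.

(** A completely positive kernel on an operator system extends to the whole
    algebra. Finitely supported matrices over [A] replace the tensor product of
    [A] with the finite rank operators, so that complete positivity becomes
    positivity of a single functional, and one application of
    [positive_extension] gives the extension, without any compactness argument. *)
Theorem arveson_extension : exists psi : A -> X -> X -> C,
  pos_kernel psi /\ forall a x y, S a -> psi a x y = theta a x y.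
Proof.
have g00 : theta_graph (0, 0).
  by exists [::]; split=> //=; [move=> *; exact: opS0|rewrite /ksum big_nil].
have K0 : kcone_real 0.
  apply: kcone_real_skew; apply/funext => x; apply/funext => y.
  by rewrite /kadj star0 oppr0.
have [G [G0 Gl Gp Gdom]] := positive_extension kcone_realD kcone_realZ g00
  theta_graph_linear theta_graph_pos.
have /choice[f fG] : forall v, exists r, (exists r', G (v, r')) -> G (v, r).
  move=> v; have [[r Gr]|nG] := pselect (exists r', G (v, r')); first by exists r.
  by exists 0.
have elemN a x y : matrix_unit (- a) x y = - matrix_unit a x y.
  by apply/funext => x'; apply/funext => y'; rewrite fctN2 /matrix_unit; case: ifP => // _; rewrite oppr0.
have elemD a b x y : matrix_unit (a + b) x y = matrix_unit a x y + matrix_unit b x y.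
  by apply/funext => x'; apply/funext => y'; rewrite fctD2 /matrix_unit; case: ifP => // _; rewrite addr0.
have elemZ (c : C) a x y : matrix_unit (c *: a) x y = c *: matrix_unit a x y.
  by apply/funext => x'; apply/funext => y'; rewrite fctZ2 /matrix_unit; case: ifP => // _; rewrite scaler0.
have Gf a x y : G (matrix_unit a x y, f (matrix_unit a x y)).
  apply: fG; apply: Gdom; first exact: elem_cofinal.
  have [w [r [Gw Kw]]] := elem_cofinal (- a) x y.
  exists (- w), (- r); split.
    have := theta_graph_linear (-1) Gw g00.
    by rewrite rmorphN1 scaleN1r mulN1r !addr0.
  by rewrite opprK addrC; move: Kw; rewrite elemN opprK.
(* positivity at 0 makes a positive graph single-valued *)
have Gfun v a b : G (v, a) -> G (v, b) -> a = b.
  move=> Ga Gb.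
  have h c d : G (v, c) -> G (v, d) -> d <= c.
    move=> Gc /(Gl (-1))/(_ Gc); rewrite rmorphN1 scaleN1r addNr mulN1r addrC => /Gp/(_ K0).
    by rewrite subr_ge0.
  by apply/eqP; rewrite eq_le !h.
have flin (r : R) a b x y :
    f (matrix_unit (r%:C *: a + b) x y) = r * f (matrix_unit a x y) + f (matrix_unit b x y).
  apply: Gfun; first exact: Gf.
  by rewrite elemD elemZ; apply: Gl.
(* the complex functional with real part [f], on the matrix units; the row index
   is [y], because [psi a x y] stands for [<phi a x, y>] *)
pose psi a x y : C := f (matrix_unit a y x) +i* (- f (matrix_unit ('i *: a) y x)).
exists psi; split; last first.
  move=> a x y Sa; have fe b : S b -> f (matrix_unit b y x) = complex.Re (theta b x y).
    by move=> Sb; apply: Gfun (Gf _ _ _) _; apply: G0; exact: theta_graph_elem.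
  rewrite /psi !fe//; last exact: opSZ.
  by rewrite thetaZ//; case: (theta a x y) => p q /=; congr (_ +i* _); ring.
split.
  move=> c a b x y; rewrite /psi.
  have -> : c *: a + b = (complex.Re c)%:C *: a + ((complex.Im c)%:C *: ('i *: a) + b).
    rewrite addrA; congr (_ + _); rewrite scalerA -scalerDl; congr (_ *: _).
    by rewrite {1}(complexE c) mulrC [in RHS]mulrC [in RHS]addrC addrC mulrC.
  rewrite !scalerDr !scalerA.
  have -> : 'i * (complex.Re c)%:C = (complex.Re c)%:C * 'i :> C by rewrite mulrC.
  have -> : 'i * ((complex.Im c)%:C * 'i) = (- complex.Im c)%:C :> C.
    by rewrite mulrCA -expr2 sqr_i mulrN1 rmorphN.
  rewrite -!scalerA !flin.
  by case: c => c1 c2 /=; apply/eqP; rewrite eq_complex /=; apply/andP; split; apply/eqP; ring.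
move=> s.
(* [kform psi s s] is the value at [v], the square of [c], of that functional *)
pose c : X -> A := fun x => \sum_(p <- s | p.2 == x) p.1.
pose v : V := \sum_(p <- s) \sum_(q <- s) matrix_unit (star q.1 * p.1) q.2 p.2.
have vE : v = rank1 c.
  apply/funext => x; apply/funext => y; rewrite /v fct_sum2 /rank1 /c.
  rewrite mulr_sumr [RHS]big_mkcond; apply: eq_bigr => p _.
  rewrite fct_sum2 star_sum mulr_suml.
  case: ifP => py.
    rewrite [RHS]big_mkcond; apply: eq_bigr => q _.
    by rewrite /matrix_unit [x == _]eq_sym [y == _]eq_sym py andbT.
  by apply: big1 => q _; rewrite /matrix_unit [y == _]eq_sym py andbF.
have vK : kcone v.
  rewrite vE; apply: (@kcone_rank1 [seq p.2 | p <- s]) => x xs.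
  rewrite /c big1_seq// => p /andP[/eqP px ps]; case/negP: xs.
  by rewrite -px; apply: map_f.
have vadj : kadj v = v by rewrite vE kadj_rank1.
have G0' : G (0, 0) by exact: G0.
have GD u w a b : G (u, a) -> G (w, b) -> G (u + w, a + b).
  by move=> /(Gl 1)/[apply]; rewrite rmorph1 scale1r mul1r.
have Gsum (F : A -> A) : G (\sum_(p <- s) \sum_(q <- s) matrix_unit (F (star q.1 * p.1)) q.2 p.2,
   \sum_(p <- s) \sum_(q <- s) f (matrix_unit (F (star q.1 * p.1)) q.2 p.2)).
  have Gbig (I : Type) (t : seq I) (v' : I -> V) (r : I -> R) :
      (forall i, G (v' i, r i)) -> G (\sum_(i <- t) v' i, \sum_(i <- t) r i).
    move=> h; elim: t => [|i t IH]; first by rewrite !big_nil.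
    by rewrite !big_cons; apply: GD.
  by apply: (Gbig) => p; apply: (Gbig) => q; exact: Gf.
have Gv : G (v, \sum_(p <- s) \sum_(q <- s) f (matrix_unit (star q.1 * p.1) q.2 p.2)).
  exact: (Gsum id).
have Giv : G ('i *: v, \sum_(p <- s) \sum_(q <- s) f (matrix_unit ('i *: (star q.1 * p.1)) q.2 p.2)).
  have := Gsum (fun a => 'i *: a).
  have -> : \sum_(p <- s) \sum_(q <- s) matrix_unit ('i *: (star q.1 * p.1)) q.2 p.2 = 'i *: v.
    rewrite /v scaler_sumr; apply: eq_bigr => p _; rewrite scaler_sumr.
    by apply: eq_bigr => q _; rewrite elemZ.
  by [].
have ivadj : kadj ('i *: v) = - ('i *: v).
  by rewrite kadjZ vadj -scaleNr; congr (_ *: _); exact: conjc_i.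
have Kv : kcone_real v by rewrite /kcone_real /= vadj; exact: kconeD.
have {}re0 := Gp _ _ Gv Kv.
have im0 := Gp _ _ Giv (kcone_real_skew ivadj).
have im1 : G (- ('i *: v), - \sum_(p <- s) \sum_(q <- s) f (matrix_unit ('i *: (star q.1 * p.1)) q.2 p.2)).
  by have := Gl (-1) _ _ _ _ Giv G0'; rewrite rmorphN1 scaleN1r mulN1r !addr0.
have Kiv : kcone_real (- ('i *: v)) by apply: kcone_real_skew; rewrite kadjN ivadj.
have {}im1 := Gp _ _ im1 Kiv; rewrite oppr_ge0 in im1.
have imE : \sum_(p <- s) \sum_(q <- s) f (matrix_unit ('i *: (star q.1 * p.1)) q.2 p.2) = 0.
  by apply/eqP; rewrite eq_le im0 im1.
have -> : kform psi s s = (\sum_(p <- s) \sum_(q <- s) f (matrix_unit (star q.1 * p.1) q.2 p.2)) +i*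
   (- \sum_(p <- s) \sum_(q <- s) f (matrix_unit ('i *: (star q.1 * p.1)) q.2 p.2)).
  have big_pair (I : Type) (t : seq I) (F1 F2 : I -> R) :
      \sum_(i <- t) (F1 i +i* F2 i) = (\sum_(i <- t) F1 i) +i* (\sum_(i <- t) F2 i) :> C.
    by elim: t => [|i t IH]; rewrite ?big_nil// !big_cons IH.
  rewrite /kform /psi; under eq_bigr do rewrite big_pair.
  rewrite big_pair; congr (_ +i* _).
  by rewrite -sumrN; apply: eq_bigr => p _; rewrite -sumrN.
by rewrite imE oppr0 ler0c.
Qed.
End Arveson.

(** * Riesz representation *)

Section RieszRepresentation.
Context {R : realType} {H : hilbertType R}.
Local Notation C := R[i].
Implicit Types x y z : H.

Lemma hilbert_complete (s : nat -> H) (t : nat -> R) :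
  t @ \oo --> (0 : R) -> (forall m n, (n <= m)%N -> hnm (s m - s n) <= t n) ->
  exists l, forall n, hnm (l - s n) <= t n.
Proof.
move=> t0 st.
have small (e : R) : 0 < e -> exists N, forall n, (N <= n)%N -> t n < e.
  move=> e0; have /cvgrPdist_lt/(_ e e0)[N _ hN] := t0.
  exists N => n /hN /=; rewrite sub0r normrN; apply: le_lt_trans; exact: ler_norm.
have Re0 (e : C) : 0 < e -> exists2 d : R, 0 < d & e = d%:C.
  move=> e0; exists (complex.Re e); first by move: e0; rewrite ltcE /= => /andP[].
  by rewrite RRe_real // gtr0_real.
have : cauchy (s @ \oo).
  apply: cauchy_exP => e /Re0[d d0 ->].
  have [N hN] := small d d0; exists (s N), N => // n /= Nn.
  rewrite -ball_normE /= hnmE ltcR hnmB.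
  exact: le_lt_trans (st _ _ Nn) (hN _ (leqnn N)).
move=> /cauchy_cvg sl; exists (lim (s @ \oo)) => n.
apply/ler_addgt0Pr => e e0.
have /cvgrPdist_lt/(_ e%:C) := sl; rewrite ltcR => /(_ e0)[N _ hN].
pose k := maxn N n.
have := hN k (leq_maxl _ _); rewrite /= hnmE ltcR => h1.
have := st k n (leq_maxr _ _) => h2.
have := hnmD (lim (s @ \oo) - s k) (s k - s n); rewrite addrA subrK; lra.
Qed.

(** The representing vector minimises [J x = |x|^2 - 2 Re (f x)]: by the
    parallelogram law a minimising sequence is Cauchy, and the first variation of
    [J] vanishes in the limit. *)
Theorem riesz_representation (f : H -> C) (M : R) :
  (forall c x y, f (c *: x + y) = c * f x + f y) ->
  (forall x, cmod (f x) <= M * hnm x) -> exists z, forall x, f x = hdot x z.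
Proof.
move=> fl fM.
have fZ c x : f (c *: x) = c * f x.
  have f0 : f 0 = 0.
    have := fl 1 0 0; rewrite scaler0 addr0 mul1r => /eqP.
    by rewrite -subr_eq0 opprD addrA subrr add0r oppr_eq0 => /eqP.
  by rewrite -[c *: x]addr0 fl f0 addr0.
pose J x : R := hnm x ^+ 2 - 2 * complex.Re (f x).
have JD (t : R) x y : J (x + t%:C *: y) =
    J x + 2 * t * (complex.Re (hdot x y) - complex.Re (f y)) + t ^+ 2 * hnm y ^+ 2.
  have hN z : hnm z ^+ 2 = complex.Re (hdot z z) by rewrite hdotxx.
  have fD : f (x + t%:C *: y) = f x + t%:C * f y by rewrite addrC fl addrC.
  rewrite /J fD !hN hdotDl !hdotDr !hdotZl !hdotZr !hdotxx (hdotC x y).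
  case: (hdot x y) => p q; case: (f x) => r s; case: (f y) => r' s' /=.
  by ring.
have Jlb : has_inf (range J).
  split; first by exists (J 0), 0.
  exists (- M ^+ 2) => _ [x _ <-].
  have := fM x; have := cmod_Re (f x); have := ler_norm (complex.Re (f x)).
  have := sqr_ge0 (hnm x - M); rewrite /J; nra.
pose m := inf (range J).
have mJ x : m <= J x by apply: ge_inf; [exact: Jlb.2|exists x].
pose e n : R := n.+1%:R^-1.
have e0 n : 0 < e n by rewrite invr_gt0.
have /choice[s sJ] : forall n, exists x, J x < m + e n ^+ 2.
  move=> n; have [_ [x _ <-] lt] := inf_adherent (exprn_gt0 2 (e0 n)) Jlb.
  by exists x.
have ele n k : (n <= k)%N -> e k <= e n.
  by move=> nk; rewrite lef_pV2 ?posrE// ler_nat ltnS.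
have par x y : hnm (x - y) ^+ 2 <= 2 * (J x + J y - 2 * m).
  have := mJ (y + (2^-1 : R)%:C *: (x - y)); rewrite JD.
  have := JD 1 y (x - y); rewrite rmorph1 scale1r addrC subrK; lra.
have [||z hz] := @hilbert_complete s (fun n => 2 * e n).
- rewrite -[X in _ --> X](mulr0 (2 : R)); apply: cvgM; first exact: cvg_cst.
  exact: cvg_harmonic.
- move=> k n nk; rewrite -(@ler_pXn2r _ 2) ?nnegrE ?hnm_ge0//; last by have := e0 n; nra.
  have := par (s k) (s n); have := sJ k; have := sJ n; have := ele _ _ nk.
  have := e0 k; have := e0 n; nra.
(* [s n] minimises [J] up to [e n ^ 2]; moving it by [e n] in the directions [y]
   and [- y] bounds the derivative *)
have vary n y : `|complex.Re (hdot (s n) y) - complex.Re (f y)|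
    <= e n * (1 + hnm y ^+ 2).
  have h1 := mJ (s n + (e n)%:C *: y); have h2 := mJ (s n + (- e n)%:C *: y).
  move: h1 h2; rewrite !JD sqrrN; have := sJ n; have p := e0 n.
  set d := _ - complex.Re (f y); set Y := hnm y ^+ 2 => h0 h1 h2.
  have h3 : e n * (2 * d) <= e n * (e n * (1 + Y)) by nra.
  have h4 : e n * (- (e n * (1 + Y))) <= e n * (2 * d) by nra.
  rewrite !ler_pM2l// in h3 h4.
  have Y0 : 0 <= Y by exact: sqr_ge0.
  have : 0 <= e n * (1 + Y) by rewrite mulr_ge0 ?ltW//; lra.
  by rewrite ler_norml => ?; apply/andP; split; lra.
have ReE y : complex.Re (f y) = complex.Re (hdot z y).
  apply/eqP; rewrite -subr_eq0 -normr_le0; apply/ler_addgt0Pl => d d0.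
  pose K := 1 + hnm y ^+ 2 + 2 * hnm y.
  have K0 : 0 < K by rewrite /K; have := sqr_ge0 (hnm y); have := hnm_ge0 y; lra.
  have /cvgrPdist_lt/(_ _ (divr_gt0 d0 K0))[N /= _ hN] := @cvg_harmonic R.
  have eN : e N < d / K.
    by have := hN N (leqnn N); rewrite sub0r normrN; apply: le_lt_trans; exact: ler_norm.
  rewrite ltr_pdivlMr// in eN.
  rewrite addr0; apply: ltW; apply: le_lt_trans eN.
  have -> : complex.Re (f y) - complex.Re (hdot z y)
     = - (complex.Re (hdot (s N) y) - complex.Re (f y)) - complex.Re (hdot (z - s N) y).
    by rewrite hdotBl raddfB /=; ring.
  apply: (le_trans (ler_normB _ _)); rewrite normrN.
  have := vary N y; have := cmod_Re (hdot (z - s N) y); have := hdot_CS (z - s N) y.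
  have := hz N; have := hnm_ge0 y; have := hnm_ge0 (z - s N); rewrite /K; nra.
(* real parts at [x] and at ['i *: x] determine the complex value *)
exists z => x; have := ReE x; have := ReE ('i *: x); rewrite fZ hdotZr (hdotC x z).
case: (f x) => p q; case: (hdot x z) => p' q' /= h1 h2.
by congr (_ +i* _); lra.
Qed.
End RieszRepresentation.

(** * Kernels and completely positive maps *)

Section KernelMaps.
Context {R : realType} {A : cstarAlgType R}.
Local Notation C := R[i].

Lemma clim_vanish (F : A -> C) (K : R) (s : nat -> A) (l : A) :
  (forall a b, F (a - b) = F a - F b) -> (forall a, cmod (F a) <= K * nm a) ->
  clim s l -> (forall n, F (s n) = 0) -> F l = 0.
Proof.
move=> FB FK sl Fs; apply: cmod_eq0; apply/eqP; rewrite eq_le cmod_ge0 andbT.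
have h n : cmod (F l) <= K * nm (s n - l).
  by rewrite nmB; have := FK (l - s n); rewrite FB Fs subr0.
have : (fun n => K * nm (s n - l)) @ \oo --> (0 : R).
  by rewrite -[X in _ --> X](mulr0 K); apply: cvgM => //; exact: cvg_cst.
move=> /(ler_cvg_to (cvg_cst (cmod (F l)))); apply; exact: nearW.
Qed.

Lemma kernel_mx_pos (X : Type) (psi : A -> X -> X -> C) m n (Y : 'M[A]_(m, n)) (xi : 'I_n -> X) :
  pos_kernel psi -> 0 <= \sum_k \sum_l psi ((starmx Y *m Y) k l) (xi l) (xi k).
Proof.
move=> psiP.
have psi_sum I (r : seq I) (P : pred I) (F : I -> A) x y :
    psi (\sum_(i <- r | P i) F i) x y = \sum_(i <- r | P i) psi (F i) x y.
  by apply: (big_morph (fun a => psi a x y)) => [a b|]; rewrite ?kernelD ?kernel0.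
under eq_bigr do under eq_bigr do (rewrite mxE psi_sum; under eq_bigr do rewrite mxE).
under eq_bigr do rewrite exchange_big.
rewrite exchange_big; apply: sumr_ge0 => i _.
have := psiP.2 [seq (Y i k, xi k) | k <- enum 'I_n].
rewrite /kform big_map big_enum /= => h.
rewrite exchange_big /=; move: h.
by congr (is_true (0 <= _)); apply: eq_bigr => k _; rewrite big_map big_enum.
Qed.

Section Hilbert.
Context {H : hilbertType R}.

Lemma ucp_kernel (phi : A -> H -> H) : ucp phi ->
  pos_kernel (fun a x y => hdot (phi a x) y).
Proof.
move=> [_ phil _ phip]; split=> [c a b x y|s].
  by rewrite phil hdotDl hdotZl.
case: s => [|p0 s0]; first by rewrite /kform big_nil.
set s := p0 :: s0; pose n := (size s0).+1.
pose Y : 'M[A]_n := \matrix_(i, k) if i == ord0 then (nth p0 s k).1 else 0.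
have E k l : (starmx Y *m Y) k l = star (nth p0 s k).1 * (nth p0 s l).1.
  rewrite mxE big_ord_recl !mxE /= big1 ?addr0// => i _.
  by rewrite !mxE /= star0 mul0r.
have := phip n (starmx Y *m Y) (ex_intro _ Y erefl) (fun k => (nth p0 s k).2).
under eq_bigr do under eq_bigr do rewrite E.
rewrite exchange_big /=; congr (is_true (0 <= _)).
rewrite /kform (big_nth p0) big_mkord; apply: eq_bigr => k _.
by rewrite (big_nth p0) big_mkord.
Qed.

Lemma rep_kernel (pi : A -> H -> H) : unital_star_rep pi ->
  pos_kernel (fun a x y => hdot (pi a x) y).
Proof.
move=> [_ pil pi1 piM pis]; split=> [c a b x y|s].
  by rewrite pil hdotDl hdotZl.
have -> : kform (fun a x y => hdot (pi a x) y) s s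
    = hdot (\sum_(p <- s) pi p.1 p.2) (\sum_(p <- s) pi p.1 p.2).
  rewrite hdot_suml; apply: eq_bigr => p _; rewrite hdot_sumr; apply: eq_bigr => q _.
  by rewrite piM pis.
by rewrite hdotxx ler0c sqr_ge0.
Qed.

Lemma rep_contractive (pi : A -> H -> H) : unital_star_rep pi ->
  forall a x, hnm (pi a x) <= nm a * hnm x.
Proof.
move=> piP a x; have [_ _ pi1 _ _] := piP.
apply: hnm_le_dot => [|z]; first by rewrite mulr_ge0 ?nm_ge0 ?hnm_ge0.
rewrite -mulrA; apply: (kernel_le (rep_kernel piP)) => {z}x y.
by rewrite pi1.
Qed.

Section KernelUcp.
Variables (psi : A -> H -> H -> C) (psiP : pos_kernel psi).
Hypothesis psi1 : forall x y, psi 1 x y = hdot x y.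

(** The vector [1 (x) (c *: x + x') - c (x) x - 1 (x) x'] is null for the
    Stinespring form. *)
Lemma kernel_linear a (c : C) x x' y :
  psi a (c *: x + x') y = c * psi a x y + psi a x' y.
Proof.
pose e z : seq (A * H) := [:: (1, z)].
pose s := e (c *: x + x') ++ (kscale (- c) (e x) ++ kscale (- 1) (e x')).
have := @kform_null _ _ _ _ psiP s [:: (star a, y)].
rewrite /s !(kform_catl, kform_catr) !(kform_scalel psiP) !(kform_scaler psiP).
rewrite !kform1 starK star1 !mul1r !mulr1 !psi1 !hdotDl !hdotDr !hdotZl !hdotZr.
rewrite !rmorphN rmorph1.
set X := psi a _ y; set Y := psi a x y; set Z := psi a x' y.
have -> : X + (- c * Y + -1 * Z) = X - (c * Y + Z) by ring.
move=> h; apply/eqP; rewrite -subr_eq0; apply/eqP/h.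
by ring.
Qed.

(** Linearity and boundedness being automatic, Riesz gives the operators. *)
Lemma kernel_ucp : exists phi : A -> H -> H,
  ucp phi /\ forall a x y, psi a x y = hdot (phi a x) y.
Proof.
have /choice[phi hphi] : forall p : A * H, exists z, forall y, psi p.1 p.2 y = hdot z y.
  move=> [a x] /=.
  have [|y|z hz] := @riesz_representation R H (fun y => psi (star a) y x) (nm a * hnm x).
  - by move=> c y y'; exact: kernel_linear.
  - rewrite -mulrA (mulrC (hnm x)) -(nm_star a); exact: (kernel_le psiP psi1).
  - by exists z => y; rewrite hdotC -hz -(kernel_star psiP) starK.
have {}hphi a x y : psi a x y = hdot (phi (a, x)) y by exact: (hphi (a, x)).
exists (fun a x => phi (a, x)); split=> //; split.
- move=> a; split.
    by move=> c x y; apply: hdot_nondeg => z; rewrite hdotDl hdotZl -!hphi kernel_linear.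
  exists (nm a)%:C => x; rewrite !hnmE -rmorphM lecR.
  apply: hnm_le_dot => [|z]; first by rewrite mulr_ge0 ?nm_ge0 ?hnm_ge0.
  by rewrite -mulrA -hphi (kernel_le psiP psi1).
- by move=> c a b x; apply: hdot_nondeg => z; rewrite hdotDl hdotZl -!hphi psiP.1.
- by move=> x; apply: hdot_nondeg => z; rewrite -hphi psi1.
- move=> n X [Y ->] xi.
  have := kernel_mx_pos Y xi psiP; congr (is_true (0 <= _)).
  by apply: eq_bigr => k _; apply: eq_bigr => l _; rewrite hphi.
Qed.
End KernelUcp.
End Hilbert.
End KernelMaps.

(** * Complete order embeddings *)

(** The conclusion of the Gelfand-Naimark theorem for [P]. For a crossed product
    it comes from the universal norm. *)
Definition norm_by_reps (R : realType) (P : cstarAlgType R) :=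
  forall (p : P) (M : R), 0 <= M ->
  (forall (H : hilbertType R) (pi : P -> H -> H), unital_star_rep pi ->
     forall x, hnm (pi p x) <= M * hnm x) -> nm p <= M.

Section Cover.
Context {R : realType} {P D : cstarAlgType R}.
Local Notation C := R[i].
Variables (T : set P) (j : T -> D).
Hypothesis opT : operator_system T.
Hypothesis jP : unital_complete_order_embedding j.

Definition into (p : P) (Tp : T p) : T := exist _ p (mem_set Tp).

(** [j], extended by 0 to [P], so that it applies to sums and products in [P]. *)
Definition ext (p : P) : D := if pselect (T p) is left Tp then j (into Tp) else 0.

Lemma extE (t : T) : ext (val t) = j t.
Proof.
rewrite /ext; case: pselect => [Tp|[]]; last exact: set_valP.
by congr j; apply: val_inj.
Qed.

Lemma ext_linear c a b : T a -> T b -> ext (c *: a + b) = c *: ext a + ext b.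
Proof.
move=> Ta Tb; have Tab : T (c *: a + b) by case: opT => _ + _; apply.
rewrite -[a]/(val (into Ta)) -[b]/(val (into Tb)) -[_ + _]/(val (into Tab)) !extE.
by case: jP => + _ _; apply.
Qed.

Lemma ext1 : ext 1 = 1.
Proof.
have T1 : T 1 by case: opT.
rewrite -[1 in LHS]/(val (into T1)) extE.
by case: jP => _ + _; apply.
Qed.

Lemma ext0 : ext 0 = 0.
Proof.
have T0 := opS0 opT; have := ext_linear 1 T0 T0; rewrite scaler0 addr0 scale1r => h.
by apply: (addrI (ext 0)); rewrite -h addr0.
Qed.

Lemma extZ c a : T a -> ext (c *: a) = c *: ext a.
Proof. by move=> Ta; rewrite -[c *: a]addr0 ext_linear ?ext0 ?addr0//; exact: opS0. Qed.

Lemma extD a b : T a -> T b -> ext (a + b) = ext a + ext b.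
Proof. by move=> Ta Tb; rewrite -[a in LHS]scale1r ext_linear ?scale1r. Qed.

Lemma extB a b : T a -> T b -> ext (a - b) = ext a - ext b.
Proof. by move=> Ta Tb; rewrite addrC -scaleN1r ext_linear// scaleN1r addrC. Qed.

Lemma ext_mxpos n (M : 'M[P]_n) : (forall k l, T (M k l)) ->
  mxpos M <-> mxpos (map_mx ext M).
Proof.
move=> TM; pose X : 'M[T]_n := \matrix_(k, l) into (TM k l).
have -> : M = map_mx val X by apply/matrixP => k l; rewrite !mxE.
have -> : map_mx ext (map_mx val X) = map_mx j X.
  by apply/matrixP => k l; rewrite !mxE extE.
by case: jP => _ _; apply.
Qed.

Lemma mxpos1 (A : cstarAlgType R) (a : A) :
  mxpos (const_mx a : 'M[A]_1) <-> exists y, a = star y * y.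
Proof.
split=> [[Y /matrixP/(_ ord0 ord0)]|[y ->]].
  by rewrite !mxE big_ord1 !mxE => ->; exists (Y ord0 ord0).
exists (const_mx y); apply/matrixP => k l.
by rewrite !mxE big_ord1 !mxE.
Qed.

Lemma ext_square a : T a -> (exists y, a = star y * y) <-> exists y, ext a = star y * y.
Proof.
move=> Ta; rewrite -2!mxpos1 (@ext_mxpos 1) => [|k l]; last by rewrite mxE.
have -> // : map_mx ext (const_mx a : 'M[P]_1) = const_mx (ext a).
by apply/matrixP => k l; rewrite !mxE.
Qed.

(** An hermitian [h] of small norm is [1] minus a square; the image of a square is
    a square, hence hermitian. *)
Lemma ext_star a : T a -> ext (star a) = star (ext a).
Proof.
have [T1 Tl Ts] := opT.
have herm1 h : T h -> star h = h -> nm h < 1 -> star (ext h) = ext h.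
  move=> Th sh h1; have [y [sy yy _]] := sqrt_one_sub sh h1.
  have T1h : T (1 - h) by rewrite -scaleN1r addrC; exact: Tl.
  have [z] : exists z, ext (1 - h) = star z * z.
    by apply: (ext_square T1h).1; exists y; rewrite sy yy.
  rewrite -scaleN1r addrC ext_linear// ext1 scaleN1r => e.
  have -> : ext h = 1 - star z * z by rewrite -e opprD opprK addrCA subrr addr0.
  by rewrite starB star1 starM starK.
have herm h : T h -> star h = h -> star (ext h) = ext h.
  move=> Th sh; pose r := nm h + 1.
  have r0 : 0 < r by rewrite /r; have := nm_ge0 h; lra.
  have e : h = r%:C *: (r^-1%:C *: h).
    by rewrite scalerA -rmorphM /= mulfV ?gt_eqF// rmorph1 scale1r.
  have Trh : T (r^-1%:C *: h) by exact: opSZ.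
  rewrite e extZ// starZr herm1//; first by rewrite starZr sh.
  by rewrite nmZr ger0_norm ?invr_ge0 ?ltW// mulrC ltr_pdivrMr// mul1r /r ltrDl.
move=> Ta; have Tsa := Ts _ Ta.
have iN : Num.conj ('i : C) = - 'i by rewrite conjcE conjc_i.
have i0 : 'i != 0 :> C by rewrite eq_complex /= oner_eq0 andbF.
have TB : T (a - star a) by exact: opSB.
have h1 : star (ext a) + star (ext (star a)) = ext a + ext (star a).
  rewrite -starD -extD//; apply: herm; first exact: opSD.
  by rewrite starD starK addrC.
have h2 : star (ext a) - star (ext (star a)) = ext (star a) - ext a.
  apply: (scalerI i0); rewrite -[RHS]opprK -scalerN opprB -extB// -starB -extB//.
  rewrite -extZ// -(herm ('i *: (a - star a))); last first.
  - by rewrite starZ iN starB starK scaleNr -scalerN opprB.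
  - exact: opSZ.
  by rewrite extZ// starZ iN scaleNr opprK.
have : star (ext a) + star (ext a) = ext (star a) + ext (star a).
  have := congr2 +%R h1 h2; rewrite addrACA subrr addr0 => ->.
  by rewrite addrC addrA subrK.
have half (z : D) : z = (2^-1 : R)%:C *: (z + z) by rewrite scale_half.
by move=> e; rewrite [LHS]half [RHS]half e.
Qed.
End Cover.

(** * Kernels on a cover of a hyperrigid operator system *)

Section CoverKernel.
Context {R : realType} {P D : cstarAlgType R}.
Local Notation C := R[i].
Variables (T : set P) (j : T -> D).
Hypothesis opT : operator_system T.
Hypothesis jP : unital_complete_order_embedding j.
Local Notation ext := (ext j).
Variables (H : hilbertType R) (pi : P -> H -> H) (piP : unital_star_rep pi).

Let piK : pos_kernel (fun a x y => hdot (pi a x) y) := rep_kernel piP.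

Definition extends_rep (psi : D -> H -> H -> C) :=
  pos_kernel psi /\ forall t x y, T t -> psi (ext t) x y = hdot (pi t x) y.

(** Both [t] and [- t] have the positive image 0, so both are positive and [pi t]
    vanishes. *)
Lemma ext_rep0 t x y : T t -> ext t = 0 -> hdot (pi t x) y = 0.
Proof.
move=> Tt t0.
have [z ez] : exists z, t = star z * z.
  by apply/(ext_square jP Tt); exists 0; rewrite mulr0.
have [w ew] : exists w, - t = star w * w.
  have Tn : T (- t) by rewrite -scaleN1r; exact: opSZ.
  apply/(ext_square jP Tn); exists 0.
  by rewrite mulr0 -scaleN1r extZ// t0 scaler0.
have d0 u : hdot (pi t u) u = 0.
  have := kernel_ge0 piK z u; rewrite -ez => h1.
  have := kernel_ge0 piK w u; rewrite -ew (kernelN piK) oppr_ge0 => h2.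
  by apply/eqP; rewrite eq_le h1 h2.
have := kernel_CS piK z z x y; rewrite -ez !d0 mul0r => h.
by apply: cmod_eq0; apply/eqP; rewrite -sqrf_eq0 eq_le h sqr_ge0.
Qed.

Lemma ext_rep_eq t t' x y : T t -> T t' -> ext t = ext t' ->
  hdot (pi t x) y = hdot (pi t' x) y.
Proof.
move=> Tt Tt' e; have := @ext_rep0 (t - t') x y (opSB opT Tt Tt').
rewrite extB// e subrr (kernelB piK) => /(_ erefl) /eqP.
by rewrite subr_eq0 => /eqP.
Qed.

(** Arveson's extension of the composite of [pi] with the inverse of [j]. *)
Lemma extends_rep_exists : exists psi, extends_rep psi.
Proof.
pose S : set D := [set ext t | t in T].
have /choice[inv invP] : forall d, exists t, S d -> T t /\ ext t = d.
  move=> d; have [[t Tt td]|nS] := pselect (S d); first by exists t.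
  by exists 0.
have [T1 Tl Ts] := opT.
have Sop : operator_system S.
  split.
  - by exists 1 => //; exact: ext1.
  - by move=> c _ _ [a Ta <-] [b Tb <-]; exists (c *: a + b); [exact: Tl|exact: ext_linear].
  - by move=> _ [a Ta <-]; exists (star a); [exact: Ts|exact: ext_star].
pose theta d (x y : H) : C := hdot (pi (inv d) x) y.
have thetaE t x y : T t -> theta (ext t) x y = hdot (pi t x) y.
  move=> Tt; have [|Ti ei] := invP (ext t); first by exists t.
  exact: ext_rep_eq.
have [||psi [psiP psiE]] := @arveson_extension R D H S theta Sop.
- move=> c _ _ x y [a Ta <-] [b Tb <-].
  rewrite -(ext_linear opT jP)// !thetaE//; last exact: Tl.
  by rewrite piK.1.
- move=> n Y xi SY.
  have TM k l : T ((\matrix_(k, l) inv ((starmx Y *m Y) k l)) k l).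
    by rewrite mxE; case: (invP _ (SY k l)).
  have [_ [|Z eZ]] := ext_mxpos jP TM.
    exists Y; apply/matrixP => k l; rewrite [LHS]mxE [X in ext X]mxE.
    by case: (invP _ (SY k l)).
  have := kernel_mx_pos Z xi piK; congr (is_true (0 <= _)).
  apply: eq_bigr => k _; apply: eq_bigr => l _; rewrite -eZ mxE.
  by [].
exists psi; split=> // t x y Tt; rewrite psiE ?thetaE//.
by exists t.
Qed.

Hypothesis hyperT : hyperrigid T.

(** Hyperrigidity enters here. A second extension [psi2], of
    [t |-> psi (star d' * j t * d) x x'], lives on [P] and on vectors [(d, x)].
    On the vectors [(1, x)] it is a unital completely positive map that agrees
    with [pi] on [T], so it is [pi] there. Cauchy-Schwarz between [t (x) (1, x)]
    and [1 (x) (j t, x)] then gives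
    [psi (star (j t) * j t) x x <= <pi t x, pi t x>], and [j t] is in the
    multiplicative domain of [psi]. *)
Lemma extends_rep_mult psi : extends_rep psi ->
  forall t, T t -> forall b x y, psi (b * ext t) x y = psi b (pi t x) y.
Proof.
move=> [psiP psiE]; have [T1 Tl Ts] := opT.
have [_ _ pi1 piM pis] := piP.
have psi1 x y : psi 1 x y = hdot x y by rewrite -(ext1 opT jP) psiE// pi1.
pose X := (D * H)%type.
pose theta p (v w : X) : C := psi (star w.1 * ext p * v.1) v.2 w.2.
have [||psi2 [psi2P psi2E]] := @arveson_extension R P X T theta opT.
- move=> c a b v w Ta Tb.
  rewrite /theta ext_linear// mulrDr mulrDl -scalerAr -scalerAl.
  exact: psiP.1.
- move=> n Y xi TY.
  have [[]] := ext_mxpos jP TY; first by exists Y.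
  move=> Z /matrixP eZ _.
  pose W := \matrix_(i, k) (Z i k * (xi k).1).
  have := kernel_mx_pos W (fun k => (xi k).2) psiP; congr (is_true (0 <= _)).
  apply: eq_bigr => k _; apply: eq_bigr => l _; rewrite /theta; congr (psi _ _ _).
  have := eZ k l; rewrite mxE => ->.
  rewrite !mxE mulr_sumr mulr_suml; apply: eq_bigr => i _.
  by rewrite !mxE starM !mulrA.
pose phi p x y := psi2 p (1, x) (1, y).
have phiP : pos_kernel phi.
  split=> [c a b x y|s]; first exact: psi2P.1.
  have := psi2P.2 [seq (p.1, (1, p.2)) | p <- s].
  rewrite /kform big_map; congr (is_true (0 <= _)).
  by apply: eq_bigr => p _; rewrite big_map.
have phiE t x y : T t -> phi t x y = hdot (pi t x) y.
  by move=> Tt; rewrite /phi psi2E// /theta /= star1 mul1r mulr1 psiE.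
have phi1 x y : phi 1 x y = hdot x y by rewrite phiE// pi1.
have [f [fucp fE]] := kernel_ucp phiP phi1.
have fpi : f = pi.
  have [_ _] := hyperT; apply=> // t Tt; apply/funext => x.
  by apply: hdot_nondeg => y; rewrite -fE phiE.
move=> t Tt; apply: multiplicative_domain => // [x y|x]; first exact: psiE.
set d := ext t; set m := psi (star d * d) x x.
have m0 : 0 <= m := kernel_ge0 psiP d x.
have [me mr0] := ge0_ReP m0.
have e1 : psi2 t (1, x) (d, x) = m by rewrite psi2E// /theta /= mulr1.
have e2 : psi2 1 (d, x) (d, x) = m by rewrite psi2E// /theta /= (ext1 opT jP) mulr1.
have e3 : psi2 (star t * t) (1, x) (1, x) = (hnm (pi t x) ^+ 2)%:C.
  by rewrite -[LHS]/(phi (star t * t) x x) fE fpi piM pis hdotxx.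
have := kernel_CS psi2P t 1 (1, x) (d, x); rewrite star1 !mul1r e1 e2 e3.
have := kernel_CS psiP d 1 x (pi t x); rewrite star1 !mul1r psi1 psiE// -/m hdotxx.
rewrite me; set r := complex.Re m in mr0 *; set q := hnm (pi t x) ^+ 2.
have q0 : 0 <= q by exact: sqr_ge0.
rewrite !cmodR /= !ger0_norm// => h1 h2; congr (_%:C).
have [|//|] := ltgtP r q; nra.
Qed.
End CoverKernel.

(** * The C*-envelope of a hyperrigid operator system *)

Section LrMorphism.
Context {R : realType} {A D : cstarAlgType R}.

Lemma lrmorphism_of (f : A -> D) :
  (forall (c : R[i]) a b, f (c *: a + b) = c *: f a + f b) -> f 1 = 1 ->
  (forall a b, f (a * b) = f a * f b) -> exists g : {lrmorphism A -> D}, g =1 f.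
Proof.
move=> fl f1 fM.
pose mL := GRing.isLinear.Build R[i] A D *:%R f fl.
pose mM := GRing.isMonoidMorphism.Build A D f (conj f1 fM).
by exists (HB.pack f mL mM : {lrmorphism A -> D}).
Qed.
End LrMorphism.

Section RepLinear.
Context {R : realType} {A : cstarAlgType R} {H : hilbertType R}.
Variables (pi : A -> H -> H) (piP : unital_star_rep pi).

Lemma repB a b x : pi (a - b) x = pi a x - pi b x.
Proof.
have [_ pil _ _ _] := piP.
by rewrite addrC -scaleN1r pil scaleN1r addrC.
Qed.
End RepLinear.

Section HyperrigidEnvelope.
Context {R : realType} {P : cstarAlgType R} (T : set P).
Local Notation C := R[i].
Hypothesis hyperT : hyperrigid T.
Hypothesis normP : norm_by_reps P.

Let opT : operator_system T. Proof. by case: hyperT. Qed.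

Section Cover.
Context {D : cstarAlgType R} (j : T -> D).
Hypothesis jP : unital_complete_order_embedding j.
Hypothesis genj : cstar_generates (range j).

(** The relation that holds between a polynomial in [j t] and the same polynomial
    in [t]. It is defined through all kernels that extend all representations,
    which makes it closed under limits from the start. *)
Definition cover_rel (d : D) (p : P) : Prop :=
  forall (H : hilbertType R) (pi : P -> H -> H), unital_star_rep pi ->
  forall psi, extends_rep j pi psi ->
  forall b x y, psi (b * d) x y = psi b (pi p x) y.

Lemma cover_rel_ext t : T t -> cover_rel (ext j t) t.
Proof. by move=> Tt H pi piP psi psiP b x y; rewrite (extends_rep_mult opT jP piP). Qed.

Lemma cover_rel1 : cover_rel 1 1.
Proof. by move=> H pi [_ _ pi1 _ _] psi psiP b x y; rewrite mulr1 pi1. Qed.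

Lemma extends_rep1 (H : hilbertType R) (pi : P -> H -> H) psi : unital_star_rep pi ->
  extends_rep j pi psi -> forall x y, psi 1 x y = hdot x y.
Proof.
move=> [_ _ pi1 _ _] [_ psiE] x y.
by rewrite -(ext1 opT jP) psiE ?pi1//; case: opT.
Qed.

Lemma cover_rel_lin c d p d' p' : cover_rel d p -> cover_rel d' p' ->
  cover_rel (c *: d + d') (c *: p + p').
Proof.
move=> h h' H pi piP psi psiP b x y.
have psi1 := extends_rep1 piP psiP; have [psiK _] := psiP.
have [_ pil _ _ _] := piP.
rewrite mulrDr -scalerAr psiK.1 (h _ _ piP _ psiP) (h' _ _ piP _ psiP).
by rewrite pil (kernel_linear psiK psi1).
Qed.

Lemma cover_relM d p d' p' : cover_rel d p -> cover_rel d' p' ->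
  cover_rel (d * d') (p * p').
Proof.
move=> h h' H pi piP psi psiP b x y; have [_ _ _ piM _] := piP.
by rewrite mulrA (h' _ _ piP _ psiP) (h _ _ piP _ psiP) piM.
Qed.

(** [psi d] and [pi p] have the same matrix coefficients, and kernels contract. *)
Lemma cover_rel_nm d p : cover_rel d p -> nm p <= nm d.
Proof.
move=> h; apply: normP => [|H pi piP x]; first exact: nm_ge0.
have [psi psiP] := extends_rep_exists opT jP piP.
have psi1 := extends_rep1 piP psiP; have [psiK _] := psiP.
apply: hnm_le_dot => [|y]; first by rewrite mulr_ge0 ?nm_ge0 ?hnm_ge0.
have := h _ _ piP _ psiP 1 x y; rewrite mul1r psi1 => <-.
by rewrite -mulrA kernel_le.
Qed.

Lemma cover_rel_clim s u d p : clim s d -> clim u p ->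
  (forall n, cover_rel (s n) (u n)) -> cover_rel d p.
Proof.
move=> sd up su H pi piP psi psiP b x y.
have psi1 := extends_rep1 piP psiP; have [psiK _] := psiP.
apply/eqP; rewrite -subr_eq0; apply/eqP/cmod_eq0/le_anti; rewrite cmod_ge0 andbT.
pose K := nm b * (hnm x * hnm y).
have h n : cmod (psi (b * d) x y - psi b (pi p x) y) <= K * (nm (s n - d) + nm (u n - p)).
  have lin z z' : psi b (z - z') y = psi b z y - psi b z' y.
    by rewrite addrC -scaleN1r (kernel_linear psiK psi1) mulN1r addrC.
  have -> : psi (b * d) x y - psi b (pi p x) y
      = psi b (pi (u n - p) x) y - psi (b * (s n - d)) x y.
    rewrite (repB piP) lin mulrBr (kernelB psiK) (su n _ _ piP _ psiP); ring.
  apply: (le_trans (cmodD _ _)); rewrite cmodN (mulrDr K) [leRHS]addrC.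
  apply: lerD; apply: (le_trans (kernel_le psiK psi1 _ _ _)); last first.
    rewrite /K mulrAC ler_wpM2r ?mulr_ge0 ?hnm_ge0//; exact: nmM.
  rewrite /K -mulrA ler_wpM2l ?nm_ge0// mulrAC ler_wpM2r ?hnm_ge0//.
  by rewrite mulrC rep_contractive.
have lim0 : (fun n => K * (nm (s n - d) + nm (u n - p))) @ \oo --> (0 : R).
  rewrite -[X in _ --> X](_ : K * (0 + 0) = 0); last by rewrite addr0 mulr0.
  by apply: cvgM; [exact: cvg_cst|exact: cvgD].
by apply: (ler_cvg_to (cvg_cst _) lim0); exact: nearW.
Qed.

(** Multiplicative domains are one sided; the graph has to be self-adjoint. *)
Definition cover_graph d p := cover_rel d p /\ cover_rel (star d) (star p).

Lemma cover_graph_lin c d p d' p' : cover_graph d p -> cover_graph d' p' ->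
  cover_graph (c *: d + d') (c *: p + p').
Proof.
move=> [h hs] [h' hs']; split; first exact: cover_rel_lin.
by rewrite !starD !starZ; exact: cover_rel_lin.
Qed.

Lemma cover_graph_functional d p p' : cover_graph d p -> cover_graph d p' -> p = p'.
Proof.
move=> h h'; have [+ _] := cover_graph_lin (-1) h' h.
rewrite !scaleN1r addNr => /cover_rel_nm; rewrite nm0 => le0.
have : nm (- p' + p) = 0 by apply/le_anti; rewrite le0 nm_ge0.
by move=> /nm_eq0; rewrite addrC => /eqP; rewrite subr_eq0 => /eqP.
Qed.

Lemma cover_graph_total d : exists p, cover_graph d p.
Proof.
suff e : [set d | exists p, cover_graph d p] = setT.
  by have : [set: D] d by []; rewrite -e.
apply: genj; last first.
  move=> _ [t _ <-]; exists (val t); rewrite -(extE j t).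
  have Tt : T (val t) by exact: set_valP.
  split; first exact: cover_rel_ext.
  rewrite -(ext_star opT jP Tt); apply: cover_rel_ext.
  by case: opT => _ _; apply.
split.
- move=> d' /norm_closure_seq[s [sP sd]].
  have /choice[u uP] := sP.
  have [|m n mn|p up] := @clim_complete R P u (fun n => 2 * harmonic n).
  + rewrite -[X in _ --> X](mulr0 (2 : R)); apply: cvgM; first exact: cvg_cst.
    exact: cvg_harmonic.
  + have : nm (s m - s n) <= 2 * harmonic n.
      have := nmD (s m - d') (d' - s n); rewrite addrA subrK nmB (nmB d').
      have := sd m; have := sd n.
      have : @harmonic R m <= harmonic n by rewrite lef_pV2 ?posrE// ler_nat ltnS.
      rewrite (nmB d'); lra.
    apply: le_trans; apply: cover_rel_nm.
    by have [+ _] := cover_graph_lin (-1) (uP n) (uP m); rewrite !scaleN1r ![- _ + _]addrC.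
  have sd' := harmonic_clim sd; exists p; split.
    by apply: (cover_rel_clim sd' up) => n; case: (uP n).
  by apply: (cover_rel_clim (clim_star sd') (clim_star up)) => n; case: (uP n).
- by exists 1; split; rewrite ?star1; exact: cover_rel1.
- by move=> c x y [p px] [q qy]; exists (c *: p + q); exact: cover_graph_lin.
- move=> x y [p [px px']] [q [qy qy']]; exists (p * q); split; first exact: cover_relM.
  by rewrite !starM; exact: cover_relM.
- by move=> x [p [px px']]; exists (star p); split; rewrite ?starK.
Qed.

Lemma cover_morphism : exists pi : {lrmorphism D -> P},
  star_preserving pi /\ forall t, pi (j t) = val t.
Proof.
have /choice[th thP] := cover_graph_total.
have thE d p : cover_graph d p -> th d = p by exact: cover_graph_functional.
have [|||pi piE] := @lrmorphism_of R D P th.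
- by move=> c a b; apply: thE; exact: cover_graph_lin.
- by apply: thE; split; rewrite ?star1; exact: cover_rel1.
- move=> a b; apply: thE; have [pa pa'] := thP a; have [pb pb'] := thP b.
  by split; [|rewrite !starM]; exact: cover_relM.
exists pi; split=> [a|t]; rewrite !piE; apply: thE.
  by have [pa pa'] := thP a; split; rewrite ?starK.
have Tt : T (val t) by exact: set_valP.
rewrite -(extE j t); split; first exact: cover_rel_ext.
rewrite -(ext_star opT jP Tt); apply: cover_rel_ext.
by case: opT => _ _; apply.
Qed.
End Cover.

Theorem hyperrigid_cstar_envelope : cstar_envelope (fun t : T => val t : P).
Proof.
have [T1 Tl Ts] := opT; split.
- by split.
- have -> : range (fun t : T => val t : P) = T.
    apply/seteqP; split=> [_ [t _ <-]|t Tt]; first exact: set_valP.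
    by exists (into Tt).
  by case: hyperT.
- by move=> D j jP genj; exact: cover_morphism.
Qed.

(** The universal properties of [P] and [F] give morphisms in both directions;
    their composites fix generating sets, and *-morphisms are contractive, hence
    continuous. *)
Theorem hyperrigid_envelope_unique (F : cstarAlgType R) (kappa : T -> F) :
  cstar_envelope kappa -> exists theta : {lrmorphism F -> P},
    [/\ star_preserving theta, bijective theta & forall t : T, theta (kappa t) = val t].
Proof.
move=> [kP kgen kuniv].
have [vP vgen _] := hyperrigid_cstar_envelope.
have [th [ths thk]] := cover_morphism kP kgen.
have [ps [pss psk]] := kuniv _ _ vP vgen.
exists th; split=> //; exists ps.
- suff e : [set a | ps (th a) = a] = setT by move=> a; have : [set: F] a by []; rewrite -e.
  apply: kgen; last by move=> _ [t _ <-] /=; rewrite thk psk.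
  split=> /=.
  + move=> a /norm_closure_seq[s [sP /harmonic_clim sa]].
    apply: (clim_unique _ sa); apply: (clim_le _ sa) => n.
    rewrite -{1}(sP n) -!rmorphB.
    apply: le_trans (star_morphism_contractive pss _) _.
    exact: star_morphism_contractive.
  + by rewrite !rmorph1.
  + by move=> c x y ex ey; rewrite linearP /= linearP /= ex ey.
  + by move=> x y ex ey; rewrite rmorphM /= rmorphM /= ex ey.
  + by move=> x ex; rewrite ths pss ex.
- suff e : [set a | th (ps a) = a] = setT by move=> a; have : [set: P] a by []; rewrite -e.
  apply: vgen; last by move=> _ [t _ <-] /=; rewrite psk thk.
  split=> /=.
  + move=> a /norm_closure_seq[s [sP /harmonic_clim sa]].
    apply: (clim_unique _ sa); apply: (clim_le _ sa) => n.
    rewrite -{1}(sP n) -!rmorphB.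
    apply: le_trans (star_morphism_contractive ths _) _.
    exact: star_morphism_contractive.
  + by rewrite !rmorph1.
  + by move=> c x y ex ey; rewrite linearP /= linearP /= ex ey.
  + by move=> x y ex ey; rewrite rmorphM /= rmorphM /= ex ey.
  + by move=> x ex; rewrite pss ths ex.
Qed.
End HyperrigidEnvelope.

(** * Hyperrigidity of the crossed product *)

Section Lspan.
Context {R : realType} {A : cstarAlgType R}.
Variable X : set A.

Lemma lspan_incl : X `<=` lspan X.
Proof. by move=> x Xx; exists 1%N, (fun=> 1), (fun=> x); split=> //; rewrite big_ord1 scale1r. Qed.

Lemma lspan_operator_system : X 1 -> (forall x, X x -> X (star x)) ->
  operator_system (lspan X).
Proof.
move=> X1 Xs; split; first exact: lspan_incl.
- move=> c _ _ [n [d [v [Xv ->]]]] [m [e [w [Xw ->]]]].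
  exists (n + m)%N, (fun k => match fintype.split k with inl k => c * d k | inr k => e k end),
    (fun k => match fintype.split k with inl k => v k | inr k => w k end); split.
    by move=> k; case: (fintype.split k) => k'.
  rewrite big_split_ord scaler_sumr /=; congr (_ + _); apply: eq_bigr => k _.
    by rewrite (unsplitK (inl k)) scalerA.
  by rewrite (unsplitK (inr k)).
- move=> _ [n [d [v [Xv ->]]]]; exists n, (fun k => Num.conj (d k)), (fun k => star (v k)).
  by split=> [k|]; [exact: Xs|rewrite star_sum; apply: eq_bigr => k _; rewrite starZ].
Qed.
End Lspan.

Section CrossedProduct.
Context {R : realType} {G : groupType} {E P : cstarAlgType R}.
Local Notation C := R[i].
Variables (beta : G -> {lrmorphism E -> E}).
Variables (i : {lrmorphism E -> P}) (u : G -> P).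
Hypothesis crossP : full_crossed_product beta i u.

Lemma cross_i_star a : i (star a) = star (i a).
Proof. by case: crossP. Qed.

Lemma cross_uM g h : u (g * h)%g = u g * u h.
Proof. by case: crossP => _ []. Qed.

Lemma cross_u1 : u 1%g = 1.
Proof.
have [_ [uu _ _] _ _] := crossP; have [h _] := uu 1%g.
by rewrite -[u 1%g]mul1r -{1}h -mulrA -cross_uM mulg1.
Qed.

Lemma cross_uV g : u g^-1%g = star (u g).
Proof.
have [_ [uu _ _] _ _] := crossP; have [h _] := uu g.
by rewrite -[LHS]mul1r -h -mulrA -cross_uM mulgV cross_u1 mulr1.
Qed.

Lemma cross_commute g a : u g * i a = i (beta g a) * u g.
Proof.
have [_ [uu _ cov] _ _] := crossP; have [h _] := uu g.
by rewrite -cov -mulrA h mulr1.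
Qed.

Definition cross_sum (s : seq (E * G)) : P := \sum_(q <- s) i q.1 * u q.2.

Lemma cross_dense p : norm_closure (range cross_sum) p.
Proof.
have [_ _ dense _] := crossP; move=> e e0.
have : [set: P] p by []; rewrite -dense => /(_ e e0) [y [[n [a [g ->]]] h]].
exists (\sum_k i (a k) * u (g k)); split=> //.
exists [seq (a k, g k) | k <- enum 'I_n] => //.
by rewrite /cross_sum big_map big_enum.
Qed.

Lemma cross_seq p : exists s : nat -> seq (E * G),
  forall n, nm (cross_sum (s n) - p) <= harmonic n.
Proof.
have [v [vP vp]] := norm_closure_seq (cross_dense p).
have /choice[s sv] : forall n, exists t, cross_sum t = v n.
  by move=> n; have [t _ tv] := vP n; exists t.
by exists s => n; rewrite sv.
Qed.

Section Hyperrigid.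
Variables (S : Type) (iota : S -> E) (gs : set G) (alpha : G -> S -> S).
Hypothesis gen_gs : group_generates gs.
Hypothesis gs1 : gs 1%g.
Hypothesis gsV : forall g, gs g -> gs g^-1%g.
Hypothesis extE : forall g s, beta g (iota s) = iota (alpha g s).
Hypothesis hyperS : hyperrigid (range iota).

Let X : set P := [set x | exists s g, gs g /\ x = i (iota s) * u g].

Lemma cross_X_i e : range iota e -> X (i e).
Proof. by move=> [s _ <-]; exists s, 1%g; rewrite cross_u1 mulr1. Qed.

Lemma cross_X_u g : gs g -> X (u g).
Proof.
move=> gg; have [[[s _ s1] _ _] _ _] := hyperS.
by exists s, g; rewrite s1 rmorph1 mul1r.
Qed.

Lemma cross_X_star x : X x -> X (star x).
Proof.
move=> [s [g [gg ->]]]; have [[_ _ Ss] _ _] := hyperS.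
have [s' _ es'] := Ss (iota s) (imageT iota s).
exists (alpha g^-1%g s'), g^-1%g; split; first exact: gsV.
by rewrite starM -cross_uV -cross_i_star -es' cross_commute extE.
Qed.

Lemma cross_generates (B : set P) : cstar_subalgebra B -> X `<=` B -> B = setT.
Proof.
move=> [Bcl B1 Bl BM Bs] XB.
have BD x y : B x -> B y -> B (x + y) by move=> *; rewrite -[x]scale1r; exact: Bl.
have B0 : B 0 by rewrite -(subrr 1) -scaleN1r addrC; exact: Bl.
have Bi e : B (i e).
  suff h : [set e | B (i e)] = setT by have : [set: E] e by []; rewrite -h.
  have [_ genS _] := hyperS; apply: genS; last by move=> x /cross_X_i; exact: XB.
  split=> /=.
  - move=> x /norm_closure_seq[s [sP /harmonic_clim sx]]; apply: Bcl.
    apply: (@clim_norm_closure _ _ _ (fun n => i (s n))) => //.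
    apply: (clim_le _ sx) => n; rewrite -rmorphB.
    by apply: star_morphism_contractive => a; exact: cross_i_star.
  - by rewrite rmorph1.
  - by move=> c x y; rewrite linearP; exact: Bl.
  - by move=> x y; rewrite rmorphM; exact: BM.
  - by move=> x; rewrite cross_i_star; exact: Bs.
have Bu : [set g | B (u g)] = setT.
  apply: gen_gs => /=; first by rewrite cross_u1.
  - by move=> g h; rewrite cross_uM; exact: BM.
  - by move=> g; rewrite cross_uV; exact: Bs.
  - by move=> g /cross_X_u; exact: XB.
apply/seteqP; split=> // p _; apply: Bcl => e e0.
have [_ [[s _ <-] h]] := cross_dense p e0; exists (cross_sum s); split=> //.
rewrite /cross_sum; elim: s {h} => [|q s IH]; first by rewrite big_nil.
rewrite big_cons; apply: BD => //; apply: BM => //.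
by have : [set: G] q.2 by []; rewrite -Bu.
Qed.

(** On the copy of [E] the two maps agree because [range iota] is hyperrigid, and
    on [u g] for [g] in [gs] because [u g] is in the span. Both families consist
    of elements of the multiplicative domain of [phi], which is closed under
    products; with density this gives the equality. *)
Theorem crossed_product_hyperrigid : hyperrigid (lspan X).
Proof.
split.
- apply: lspan_operator_system; last exact: cross_X_star.
  by rewrite -cross_u1; exact: cross_X_u.
- move=> B Bsub XB; apply: cross_generates => //.
  by apply: subset_trans XB; exact: lspan_incl.
move=> H pi phi piP phiP agree.
have [pib pil pi1 piM pis] := piP; have [phib phil phi1 phip] := phiP.
have piK := rep_kernel piP.
have agX x : X x -> phi x = pi x by move=> Xx; apply: agree; exact: lspan_incl.
have agi e : phi (i e) = pi (i e).
  have [_ _ uniq] := hyperS.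
  suff : (fun e => phi (i e)) = (fun e => pi (i e)).
    by move=> h; exact: (congr1 (fun f => f e) h).
  apply: uniq.
  - split=> [a|c a b x|x|a b x|a x y]; first exact: pib.
    + by rewrite linearP pil.
    + by rewrite rmorph1.
    + by rewrite rmorphM piM.
    + by rewrite /= cross_i_star pis.
  - split=> [a|c a b x|x|n Y [Z ->] xi]; first exact: phib.
    + by rewrite linearP phil.
    + by rewrite rmorph1.
    + have := phip n (map_mx i (starmx Z *m Z)) _ xi.
      have -> : map_mx i (starmx Z *m Z) = starmx (map_mx i Z) *m map_mx i Z.
        apply/matrixP => k l; rewrite !mxE rmorph_sum; apply: eq_bigr => m _.
        by rewrite !mxE rmorphM /= cross_i_star.
      move=> /(_ (ex_intro _ _ erefl)); congr (is_true (0 <= _)).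
      apply: eq_bigr => k _; apply: eq_bigr => l _.
      congr (hdot (phi _ _) _); rewrite !mxE rmorph_sum; apply: eq_bigr => m _.
      by rewrite !mxE rmorphM /= cross_i_star.
  - by move=> _ [s _ <-]; apply: agX; apply: cross_X_i; exists s.
pose psi a x y : C := hdot (phi a x) y.
have phiK : pos_kernel psi := ucp_kernel phiP.
have psi1 x y : psi 1 x y = hdot x y by rewrite /psi phi1.
pose M := [set p | forall b x y, psi (b * p) x y = psi b (pi p x) y].
have Mdom p : phi p = pi p -> phi (star p * p) = pi (star p * p) -> M p.
  move=> e1 e2; apply: (multiplicative_domain phiK psi1) => [x y|x].
    by rewrite /psi e1.
  by rewrite /psi e2 piM pis.
have MM p q : M p -> M q -> M (p * q).
  by move=> Mp Mq b x y; rewrite mulrA Mq Mp piM.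
have Mi e : M (i e).
  by apply: Mdom; rewrite ?agi// -cross_i_star -rmorphM agi.
(* inverses are included to make this set of group elements a subgroup *)
have Mu : [set g | M (u g) /\ M (u g^-1%g)] = setT.
  have Mug g : gs g -> M (u g).
    move=> gg; apply: Mdom; first exact/agX/cross_X_u.
    have [_ [uu _ _] _ _] := crossP; have [-> _] := uu g.
    by apply/funext => x; rewrite phi1 pi1.
  apply: gen_gs => /=.
  - by rewrite invg1; split; exact: Mug.
  - by move=> g h [? ?] [? ?]; rewrite invgM !cross_uM; split; exact: MM.
  - by move=> g [? ?]; rewrite invgK.
  - by move=> g gg; split; apply: Mug => //; exact: gsV.
have Msum s x y : psi (cross_sum s) x y = hdot (pi (cross_sum s) x) y.
  rewrite /cross_sum; elim: s => [|q s IH].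
    by rewrite big_nil (kernel0 phiK) (kernel0 piK).
  rewrite big_cons (kernelD phiK) (kernelD piK) IH; congr (_ + _).
  have [Mq _] : [set g | M (u g) /\ M (u g^-1%g)] q.2 by rewrite Mu.
  by have := MM _ _ (Mi q.1) Mq 1 x y; rewrite mul1r psi1.
apply/funext => p; apply/funext => x; apply: hdot_nondeg => y.
have [K hK] := kernel_bounded phiK x y; have [L hL] := kernel_bounded piK x y.
have [s sp] := cross_seq p.
apply/eqP; rewrite -[hdot (phi p x) y]/(psi p x y) -subr_eq0; apply/eqP.
apply: (@clim_vanish _ _ (fun p => psi p x y - hdot (pi p x) y) (K + L)
          (fun n => cross_sum (s n))) => [a b|a||n].
- by rewrite (kernelB phiK) (kernelB piK); ring.
- by apply: (le_trans (cmodD _ _)); rewrite cmodN mulrDl lerD.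
- exact: harmonic_clim.
- by rewrite Msum subrr.
Qed.
End Hyperrigid.
End CrossedProduct.

(** * Covariant representations determine the norm of the crossed product *)

Section CovariantRep.
Context {R : realType} {G : groupType} {E P : cstarAlgType R}.
Local Notation C := R[i].
Variables (beta : G -> {lrmorphism E -> E}).
Variables (i : {lrmorphism E -> P}) (u : G -> P).
Hypothesis crossP : full_crossed_product beta i u.
Local Notation cross_sum := (cross_sum i u).
Implicit Types s t : seq (E * G).

Definition scale_seq (c : C) s := [seq (c *: q.1, q.2) | q <- s].
Definition mul_seq s t :=
  [seq (q.1 * beta q.2 r.1, (q.2 * r.2)%g) | q <- s, r <- t].
Definition star_seq s := [seq (beta q.2^-1%g (star q.1), q.2^-1%g) | q <- s].

Lemma cross_sum_cat s t : cross_sum (s ++ t) = cross_sum s + cross_sum t.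
Proof. exact: big_cat. Qed.

Lemma cross_sum_scale c s : cross_sum (scale_seq c s) = c *: cross_sum s.
Proof.
rewrite /cross_sum big_map scaler_sumr; apply: eq_bigr => q _ /=.
by rewrite linearZ /= scalerAl.
Qed.

Lemma cross_sum_mul s t : cross_sum (mul_seq s t) = cross_sum s * cross_sum t.
Proof.
rewrite /cross_sum big_allpairs_dep mulr_suml; apply: eq_bigr => q _.
rewrite mulr_sumr; apply: eq_bigr => r _ /=.
by rewrite rmorphM /= (cross_uM crossP) -!mulrA; congr (_ * _); rewrite !mulrA (cross_commute crossP).
Qed.

Lemma cross_sum_star s : cross_sum (star_seq s) = star (cross_sum s).
Proof.
rewrite /cross_sum big_map star_sum; apply: eq_bigr => q _ /=.
by rewrite starM -(cross_uV crossP) -(cross_i_star crossP) (cross_commute crossP).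
Qed.

Section Extension.
Context {H : hilbertType R}.
Variables (pi : E -> H -> H) (U : G -> H -> H).
Hypothesis piU : covariant_rep beta pi U.

Definition rep_sum s x : H := \sum_(q <- s) pi q.1 (U q.2 x).

Let piP : unital_star_rep pi. Proof. by case: piU. Qed.
Let UD g x y : U g (x + y) = U g x + U g y.
Proof. by case: piU => _ [Ul _ _ _] _; rewrite -[x]scale1r Ul !scale1r. Qed.
Let pil a c x y : pi a (c *: x + y) = c *: pi a x + pi a y.
Proof. by case: piP => /(_ a)[+ _] _ _ _ _; apply. Qed.
Let pi0 a : pi a 0 = 0.
Proof. by have := pil a 1 0 0; rewrite scaler0 addr0 scale1r => h; apply: (addrI (pi a 0)); rewrite -h addr0. Qed.
Let piD a x y : pi a (x + y) = pi a x + pi a y.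
Proof. by rewrite -[x]scale1r pil !scale1r. Qed.

Lemma rep_sum_linear s c x y : rep_sum s (c *: x + y) = c *: rep_sum s x + rep_sum s y.
Proof.
rewrite /rep_sum scaler_sumr -big_split; apply: eq_bigr => q _ /=.
by case: piU => _ [Ul _ _ _] _; rewrite Ul pil.
Qed.

Lemma rep_sum_cat s t x : rep_sum (s ++ t) x = rep_sum s x + rep_sum t x.
Proof. exact: big_cat. Qed.

Lemma rep_sum_scale c s x : rep_sum (scale_seq c s) x = c *: rep_sum s x.
Proof.
rewrite /rep_sum big_map scaler_sumr; apply: eq_bigr => q _ /=.
have [_ pl _ _ _] := piP.
have p0 z : pi 0 z = 0 by rewrite -(subrr 0) (repB piP) subrr.
by have := pl c q.1 0 (U q.2 x); rewrite p0 !addr0.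
Qed.

Lemma rep_sum_mul s t x : rep_sum (mul_seq s t) x = rep_sum s (rep_sum t x).
Proof.
have [_ [Ul _ UM _] cov] := piU; have [_ _ _ piM _] := piP.
have Ucov g a z : U g (pi a z) = pi (beta g a) (U g z).
  have U1 : U g^-1%g (U g z) = z.
    by rewrite -UM mulVg; case: piU => _ [].
  by rewrite -(cov g a (U g z)) U1.
have U0 g : U g 0 = 0 by apply: (addrI (U g 0)); rewrite -UD !addr0.
rewrite /rep_sum big_allpairs_dep; apply: eq_bigr => q _.
rewrite (big_morph (U q.2) (UD q.2) (U0 q.2)) (big_morph (pi q.1) (piD q.1) (pi0 q.1)).
by apply: eq_bigr => r _ /=; rewrite piM UM Ucov.
Qed.

Lemma rep_sum_star s x y : hdot (rep_sum (star_seq s) x) y = hdot x (rep_sum s y).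
Proof.
have [_ [_ U1 UM Uiso] cov] := piU; have [_ _ _ _ pis] := piP.
rewrite /rep_sum big_map hdot_suml hdot_sumr; apply: eq_bigr => q _ /=.
set g := q.2; set a := q.1.
have -> : pi (beta g^-1%g (star a)) (U g^-1%g x) = U g^-1%g (pi (star a) x).
  by rewrite -cov -UM invgK mulgV U1.
by rewrite -(Uiso g) -UM mulgV U1 pis.
Qed.

Lemma rep_sum_le s x : hnm (rep_sum s x) <= nm (cross_sum s) * hnm x.
Proof.
have [_ _ _ univ] := crossP.
have [+ _] := univ (size s) (fun k => (tnth (in_tuple s) k).1) (fun k => (tnth (in_tuple s) k).2).
move=> /(_ H pi U piU x).
have -> : \sum_k i (tnth (in_tuple s) k).1 * u (tnth (in_tuple s) k).2 = cross_sum s.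
  by rewrite /cross_sum [RHS]big_tnth.
have -> : \sum_k pi (tnth (in_tuple s) k).1 (U (tnth (in_tuple s) k).2 x) = rep_sum s x.
  by rewrite /rep_sum [RHS]big_tnth.
by rewrite cnormE !hnmE -rmorphM lecR.
Qed.

Lemma rep_sumB s t x :
  hnm (rep_sum s x - rep_sum t x) <= nm (cross_sum s - cross_sum t) * hnm x.
Proof.
have := rep_sum_le (s ++ scale_seq (-1) t) x.
by rewrite rep_sum_cat cross_sum_cat rep_sum_scale cross_sum_scale !scaleN1r.
Qed.

(** The point common to all the balls is the limit of [rep_sum s x] along finite
    sums that converge to [p]. *)
Lemma rep_extend p x : exists y, forall s,
  hnm (y - rep_sum s x) <= nm (p - cross_sum s) * hnm x.
Proof.
have [s sp] := cross_seq crossP p.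
have h0 := hnm_ge0 x.
have lim0 (K : R) : (fun n => K * harmonic n) @ \oo --> (0 : R).
  by rewrite -[X in _ --> X](mulr0 K); apply: cvgM; [exact: cvg_cst|exact: cvg_harmonic].
have dist n t : nm (cross_sum (s n) - cross_sum t) <= harmonic n + nm (p - cross_sum t).
  have := nmD (cross_sum (s n) - p) (p - cross_sum t); rewrite addrA subrK.
  by move=> /le_trans; apply; rewrite lerD2r.
have [|m n mn|y hy] := @hilbert_complete _ _ (fun n => rep_sum (s n) x) (fun n => 2 * hnm x * harmonic n).
- exact: lim0.
- apply: (le_trans (rep_sumB _ _ _)); rewrite mulrAC; apply: ler_wpM2r => //.
  apply: (le_trans (dist _ _)); rewrite nmB.
  have : @harmonic R m <= harmonic n by rewrite lef_pV2 ?posrE// ler_nat ltnS.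
  by have := sp n; lra.
exists y => t; rewrite -subr_le0.
apply: (ler_cvg_to (cvg_cst _) (lim0 (3 * hnm x))); apply: nearW => n.
have := hnmD (y - rep_sum (s n) x) (rep_sum (s n) x - rep_sum t x); rewrite addrA subrK.
have := hy n; have := rep_sumB (s n) t x.
have := ler_wpM2r h0 (dist n t); rewrite /=; move: (n.+1%:R^-1) => h; lra.
Qed.

(** The integrated form of a covariant representation. The estimate of
    [rep_extend] pins the extension down, and the algebraic identities pass from
    the finite sums to [P] by continuity. *)
Lemma covariant_rep_extension : exists rho : P -> H -> H,
  unital_star_rep rho /\ forall s x, rho (cross_sum s) x = rep_sum s x.
Proof.
have /choice[rho rhoP] : forall q : P * H, exists y, forall s,
    hnm (y - rep_sum s q.2) <= nm (q.1 - cross_sum s) * hnm q.2.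
  by move=> [p x]; exact: rep_extend.
have {}rhoP p x s : hnm (rho (p, x) - rep_sum s x) <= nm (p - cross_sum s) * hnm x.
  exact: (rhoP (p, x)).
have rhoE s x : rho (cross_sum s, x) = rep_sum s x.
  have := rhoP (cross_sum s) x s; rewrite subrr nm0 mul0r => h.
  by apply/eqP; rewrite -subr_eq0; apply/eqP/hnm_eq0/le_anti; rewrite h hnm_ge0.
have rho_le p x : hnm (rho (p, x)) <= nm p * hnm x.
  by have := rhoP p x [::]; rewrite /rep_sum /cross_sum !big_nil !subr0.
have rho_lin c p q x : rho (c *: p + q, x) = c *: rho (p, x) + rho (q, x).
  apply/eqP; rewrite -subr_eq0; apply/eqP/hnm_eq0/le_anti; rewrite hnm_ge0 andbT.
  have [s sp] := cross_seq crossP p; have [t tq] := cross_seq crossP q.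
  pose K := 2 * (cmod c + 1) * hnm x.
  have lim0 : (fun n => K * harmonic n) @ \oo --> (0 : R).
    by rewrite -[X in _ --> X](mulr0 K); apply: cvgM; [exact: cvg_cst|exact: cvg_harmonic].
  apply: (ler_cvg_to (cvg_cst _) lim0); apply: nearW => n.
  have h1 := rhoP (c *: p + q) x (scale_seq c (s n) ++ t n).
  rewrite rep_sum_cat cross_sum_cat rep_sum_scale cross_sum_scale in h1.
  have h2 := rhoP p x (s n); have h3 := rhoP q x (t n).
  rewrite nmB in h2; rewrite nmB in h3.
  set ps := rep_sum (s n) x in h1 h2 *; set pt := rep_sum (t n) x in h1 h3 *.
  have d1 : nm (c *: p + q - (c *: cross_sum (s n) + cross_sum (t n)))
      <= (cmod c + 1) * harmonic n.
    rewrite opprD addrACA -scalerBr; apply: (le_trans (nmD _ _)).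
    rewrite nmZ -/(cmod c) nmB (nmB q) mulrDl mul1r.
    by apply: lerD => //; apply: ler_wpM2l => //; exact: cmod_ge0.
  have -> : rho (c *: p + q, x) - (c *: rho (p, x) + rho (q, x))
    = (rho (c *: p + q, x) - (c *: ps + pt)) + (c *: (ps - rho (p, x)) + (pt - rho (q, x))).
    by rewrite scalerBr [c *: ps - _ + _]addrACA -opprD addrA subrK.
  apply: (le_trans (hnmD _ _)).
  have -> : K * harmonic n = (cmod c + 1) * harmonic n * hnm x
      + (cmod c * (harmonic n * hnm x) + harmonic n * hnm x) by rewrite /K /=; ring.
  have h0 := hnm_ge0 x.
  apply: lerD; first by apply: (le_trans h1); exact: ler_wpM2r.
  apply: (le_trans (hnmD _ _)); rewrite hnmZ hnmB (hnmB pt); apply: lerD.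
    apply: ler_wpM2l; first exact: cmod_ge0.
    by apply: (le_trans h2); exact: ler_wpM2r.
  by apply: (le_trans h3); exact: ler_wpM2r.
have rhoB p q x : rho (p - q, x) = rho (p, x) - rho (q, x).
  by rewrite addrC -scaleN1r rho_lin scaleN1r addrC.
have extend (F : P -> H) (K : R) : (forall a b, F (a - b) = F a - F b) ->
    (forall a, hnm (F a) <= K * nm a) -> (forall s, F (cross_sum s) = 0) ->
    forall p, F p = 0.
  move=> FB FK F0 p; have [s sp] := cross_seq crossP p.
  apply: hdot_nondeg => y; rewrite hdot0l.
  apply: (@clim_vanish _ _ (fun p => hdot (F p) y) (K * hnm y)
            (fun n => cross_sum (s n))) => [a b|a||n].
  - by rewrite FB hdotBl.
  - apply: (le_trans (hdot_CS _ _)); rewrite mulrAC.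
    by apply: ler_wpM2r => //; exact: hnm_ge0.
  - exact: harmonic_clim.
  - by rewrite F0 hdot0l.
have rho_linx p c x y : rho (p, c *: x + y) = c *: rho (p, x) + rho (p, y).
  apply/eqP; rewrite -subr_eq0; apply/eqP.
  apply: (extend (fun p => rho (p, c *: x + y) - (c *: rho (p, x) + rho (p, y)))
            (hnm (c *: x + y) + (cmod c * hnm x + hnm y))) => [a b|a|s].
  - have add4 (X X' V V' : H) : X - X' - (V - V') = (X - V) - (X' - V').
      by rewrite opprD addrACA -opprD.
    by rewrite !rhoB scalerBr [c *: _ - _ + _]addrACA -opprD add4.
  - apply: (le_trans (hnmD _ _)); rewrite -scaleN1r hnmZ cmodN [cmod 1]/cmod normr1 mul1r mulrDl.
    apply: lerD; first by rewrite mulrC.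
    apply: (le_trans (hnmD _ _)); rewrite hnmZ mulrDl; apply: lerD; last by rewrite mulrC.
    by rewrite -mulrA; apply: ler_wpM2l; [exact: cmod_ge0|rewrite mulrC].
  - by rewrite !rhoE rep_sum_linear subrr.
have rhoBx p x y : rho (p, x - y) = rho (p, x) - rho (p, y).
  by rewrite addrC -scaleN1r rho_linx scaleN1r addrC.
have hnmB_le (x y : H) : hnm (x - y) <= hnm x + hnm y.
  by apply: (le_trans (hnmD _ _)); rewrite -[- y]add0r hnmB subr0.
have rhoM p q x : rho (p * q, x) = rho (p, rho (q, x)).
  have step t : rho (p * cross_sum t, x) = rho (p, rho (cross_sum t, x)).
    apply/eqP; rewrite -subr_eq0; apply/eqP.
    apply: (extend (fun p => rho (p * cross_sum t, x) - rho (p, rho (cross_sum t, x)))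
              (2 * (nm (cross_sum t) * hnm x))) => [a b|a|s].
    - by rewrite mulrBl !rhoB !opprD addrACA.
    - apply: (le_trans (hnmB_le _ _)).
      have h1 := rho_le (a * cross_sum t) x; have h2 := rho_le a (rho (cross_sum t, x)).
      have h3 := ler_wpM2l (nm_ge0 a) (rho_le (cross_sum t) x).
      have h4 := ler_wpM2r (hnm_ge0 x) (nmM a (cross_sum t)).
      nra.
    - by rewrite -cross_sum_mul !rhoE rep_sum_mul subrr.
  apply/eqP; rewrite -subr_eq0; apply/eqP.
  apply: (extend (fun q => rho (p * q, x) - rho (p, rho (q, x)))
              (2 * (nm p * hnm x))) => [a b|a|s].
  - by rewrite mulrBr !rhoB rhoBx !opprD addrACA.
  - apply: (le_trans (hnmB_le _ _)).
    have h1 := rho_le (p * a) x; have h2 := rho_le p (rho (a, x)).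
    have h3 := ler_wpM2l (nm_ge0 p) (rho_le a x).
    have h4 := ler_wpM2r (hnm_ge0 x) (nmM p a).
    nra.
  - by rewrite step subrr.
have rho_star p x y : hdot (rho (star p, x)) y = hdot x (rho (p, y)).
  apply/eqP; rewrite -subr_eq0; apply/eqP.
  have [s sp] := cross_seq crossP p.
  apply: (@clim_vanish _ _ (fun p => hdot (rho (star p, x)) y - hdot x (rho (p, y)))
    (2 * (hnm x * hnm y)) (fun n => cross_sum (s n))) => [a b|a||n].
  - rewrite starB !rhoB hdotBl [hdot x (_ - _)]hdotC hdotBl rmorphB /= -!hdotC; ring.
  - apply: (le_trans (cmodD _ _)); rewrite cmodN.
    have h1 := hdot_CS (rho (star a, x)) y; have h2 := hdot_CS x (rho (a, y)).
    have h3 := ler_wpM2r (hnm_ge0 y) (rho_le (star a) x); rewrite nm_star in h3.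
    have h4 := ler_wpM2l (hnm_ge0 x) (rho_le a y).
    nra.
  - exact: harmonic_clim.
  - by rewrite -cross_sum_star !rhoE rep_sum_star subrr.
exists (fun p x => rho (p, x)); split; last exact: rhoE.
split=> //.
- move=> a; split; first by move=> c x y; exact: rho_linx.
  by exists (nm a)%:C => x; rewrite !hnmE -rmorphM lecR.
- move=> x; have -> : 1 = cross_sum [:: (1, 1%g)].
    by rewrite /cross_sum big_seq1 (cross_u1 crossP) rmorph1 mulr1.
  rewrite rhoE /rep_sum big_seq1 /=.
  by case: piU => _ [_ U1 _ _] _; case: piP => _ _ p1 _ _; rewrite U1 p1.
Qed.
End Extension.

Lemma crossed_product_norm_by_reps : norm_by_reps P.
Proof.
move=> p M M0 hM.
have [s sp] := cross_seq crossP p.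
have lim0 : (fun n => M + 2 * harmonic n) @ \oo --> M.
  rewrite -[X in _ --> X]addr0; apply: cvgD; first exact: cvg_cst.
  rewrite -[X in _ --> X](mulr0 (2 : R)); apply: cvgM; first exact: cvg_cst.
  exact: cvg_harmonic.
apply: (ler_cvg_to (cvg_cst _) lim0); apply: nearW => n.
suff h : nm (cross_sum (s n)) <= M + harmonic n.
  have := nmD (p - cross_sum (s n)) (cross_sum (s n)); rewrite subrK nmB.
  by have := sp n; lra.
have hn0 : 0 <= @harmonic R n by rewrite invr_ge0.
have [_ _ _ univ] := crossP.
have [_] := univ (size (s n)) (fun k => (tnth (in_tuple (s n)) k).1) (fun k => (tnth (in_tuple (s n)) k).2).
have -> : \sum_k i (tnth (in_tuple (s n)) k).1 * u (tnth (in_tuple (s n)) k).2 = cross_sum (s n).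
  by rewrite /cross_sum [RHS]big_tnth.
move=> /(_ (M + harmonic n)%:C); rewrite ler0c cnormE lecR; apply; first exact: addr_ge0.
move=> H pi U piU x.
have -> : \sum_k pi (tnth (in_tuple (s n)) k).1 (U (tnth (in_tuple (s n)) k).2 x) = rep_sum pi U (s n) x.
  by rewrite /rep_sum [RHS]big_tnth.
have [rho [rhoP rhoE]] := covariant_rep_extension piU.
rewrite !hnmE -rmorphM lecR -rhoE.
have -> : rho (cross_sum (s n)) x = rho p x + rho (cross_sum (s n) - p) x.
  by rewrite (repB rhoP) addrCA subrr addr0.
apply: (le_trans (hnmD _ _)); rewrite mulrDl; apply: lerD; first exact: hM.
apply: (le_trans (rep_contractive rhoP _ _)); apply: ler_wpM2r => //.
exact: hnm_ge0.
Qed.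
End CovariantRep.

(** * The enveloping crossed product *)

Theorem theorem4p11 (R : realType) (B : cstarAlgType R) (S : set B)
    (G : groupType) (gs : set G) (alpha : G -> S -> S)
    (dynS : dynamical_system gs alpha)
    (E : cstarAlgType R) (iota : S -> E) (envE : cstar_envelope iota)
    (alphaE : G -> {lrmorphism E -> E}) (actE : star_action alphaE)
    (extE : forall g s, alphaE g (iota s) = iota (alpha g s))
    (P : cstarAlgType R) (i : {lrmorphism E -> P}) (u : G -> P)
    (crossP : full_crossed_product alphaE i u)
    (hyperS : hyperrigid (range iota)) :
  let T : set P := enveloping_crossed_product iota gs i u in
  [/\ hyperrigid T,
      cstar_envelope (fun t : T => val t : P)
    & forall (F : cstarAlgType R) (kappa : T -> F), cstar_envelope kappa ->
        exists theta : {lrmorphism F -> P},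
          [/\ star_preserving theta, bijective theta
            & forall t : T, theta (kappa t) = val t]].
Proof.
move=> T.
have [_ [gen_gs gs1 gsV] _ _] := dynS.
have hyperT : hyperrigid T.
  exact: (crossed_product_hyperrigid crossP gen_gs gs1 gsV extE hyperS).
have normP := crossed_product_norm_by_reps crossP.
split=> //; first exact: hyperrigid_cstar_envelope.
by move=> F kappa; exact: hyperrigid_envelope_unique.
Qed.
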